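(* Let $k\ge 3$ and $n\ge 2$ be integers such that $m=kn/2$ is an integer. For an integer $g$ let $\mathcal{D}_{n,m}(g)$ denote the set of all $k$-regular graphs in $\mathcal{G}_{n,m}$ that do not contain non-trivial cut sets with at most $g(k-2)$ edges. Suppose there exists $g\ge 4$ such that $\mathcal{D}_{n,m}(g)\neq\emptyset$. Then, for this $g$, $$\mathcal{A}_{g(k-2)}=\mathcal{D}_{n,m}(g).$$
   Context: $\mathcal{G}_{n,m}$ is the set of all (finite, undirected) multigraphs with $n$ vertices and $m$ edges. A cut set of $G$ is a set of edges whose removal leaves a disconnected graph; $b_j(G)$ denotes the number of cut sets of $G$ with exactly $j$ edges. If each edge fails independently with probability $p$, the probability that $G$ becomes disconnected is $U_G(p)=\sum_{j} b_j(G)\,p^j(1-p)^{m-j}$. Reliability classes: $\mathcal{A}_0=\mathcal{G}_{n,m}$, and for $j\ge1$, $\mathcal{A}_j$ is the set of graphs in $\mathcal{A}_{j-1}$ that have the smallest value of $b_j$ among all graphs in $\mathcal{A}_{j-1}$. (For $j>m$ one has $b_j=0$, so $\mathcal{A}_j=\mathcal{A}_m$.) A minimal cut set is a cut set that does not properly contain another cut set. For a connected subgraph $X$ of $G$, $\partial(X)$ is the set of edges connecting $X$ to its complement $G-X$. In a graph $G$ of girth $h$, a minimal cut set is called trivial if it is of the form $\partial(T)$ for a subtree $T$ of $G$ with at most $h-1$ vertices; every other minimal cut set is called non-trivial. (Loops are cycles of length 1 and pairs of parallel edges are cycles of length 2.) *)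

(* Defs.v *)
From mathcomp Require Import all_boot.

Set Implicit Arguments.
Unset Strict Implicit.
Unset Printing Implicit Defensive.

(* Multigraphs on the vertex set 'I_n with edge set 'I_m: every edge carries
   its set of ends, which is a singleton for a loop and a pair otherwise;
   parallel edges are distinct edges with the same ends. *)
Definition mgraph (n m : nat) : Type :=
  {ends : {ffun 'I_m -> {set 'I_n}} | [forall e, 0 < #|ends e| <= 2]}.

Section MultiGraph.

Variables n m : nat.
Implicit Types (G : mgraph n m) (S : {set 'I_n}) (C F : {set 'I_m}).

Definition ends G (e : 'I_m) : {set 'I_n} := val G e.

(* A loop contributes 2. *)
Definition degree G (x : 'I_n) : nat :=
  #|[set e | x \in ends G e]| + #|[set e | ends G e == [set x]]|.

Definition regular (k : nat) G : bool := [forall x, degree G x == k].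

(* Subgraphs are pairs of a vertex set S and an edge set F. *)
Definition subgraph G S F : bool := [forall e in F, ends G e \subset S].

Definition adj G F : rel 'I_n :=
  fun x y => [exists e in F, ends G e == [set x; y]].

Definition connected G S F : bool :=
  (S != set0) && [forall x in S, forall y in S, connect (adj G F) x y].

(* F contains a cycle of length l: distinct vertices v_0, ..., v_(l-1) and
   distinct edges c_i with ends v_i and v_(i+1 mod l). *)
Definition has_cycle G F (l : nat) : bool :=
  (0 < l) &&
  [exists v : {ffun 'I_l -> 'I_n}, exists c : {ffun 'I_l -> 'I_m},
    [&& injectiveb v, injectiveb c
      & [forall i, (c i \in F) && (ends G (c i) == [set v i; v (ordS i)])]]].

(* Cycles have length at most n; a graph without cycles gets the value n.+1,
   which, like an infinite girth, exceeds the order of every subgraph. *)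
Definition girth G : nat :=
  \big[minn/n.+1]_(l < n.+1 | has_cycle G setT l) l.

Definition subtree G S F : bool :=
  [&& subgraph G S F, connected G S F
    & ~~ [exists l : 'I_n.+1, has_cycle G F l]].

Definition cut_set G C : bool := ~~ connected G setT (~: C).

Definition num_cut_sets (j : nat) G : nat :=
  #|[set C | cut_set G C & #|C| == j]|.

Definition minimal_cut_set G C : bool := minset (cut_set G) C.

(* The edges joining a subgraph with vertex set S to its complement. *)
Definition boundary G S : {set 'I_m} :=
  [set e | [exists x in S, exists y in ~: S, ends G e == [set x; y]]].

Definition trivial_cut_set G C : bool :=
  minimal_cut_set G C &&
  [exists S : {set 'I_n}, exists F : {set 'I_m},
    [&& subtree G S F, #|S| <= (girth G).-1 & C == boundary G S]].

Definition nontrivial_cut_set G C : bool :=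
  minimal_cut_set G C && ~~ trivial_cut_set G C.

End MultiGraph.

Fixpoint calA (n m j : nat) : {set mgraph n m} :=
  if j is i.+1 then
    [set G in calA n m i |
      [forall H in calA n m i, num_cut_sets j G <= num_cut_sets j H]]
  else setT.

Definition calD (n m k g : nat) : {set mgraph n m} :=
  [set G | regular k G &
    ~~ [exists C, nontrivial_cut_set G C && (#|C| <= g * (k - 2))]].

(* Main.v *)
(* Write d(S) for the boundary and E(S) for the set of inner edges of a vertex
   set S, and let D_j be the set of k-regular graphs all of whose minimal cut
   sets with at most j edges are trivial.  A_(k-1) = D_(k-1), and the theorem
   follows by induction once, for G in D_(j-1), b_j(G) is shown to be the number
   of non-trivial minimal cut sets with j edges plus a number independent of G.
   If j >= m - n + 2, every j-set is a cut set.  Otherwise let L be the largest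
   order of a tree whose boundary has at most j edges.  A shortest cycle of
   length h has at most h(k-2) boundary edges, which forces the girth to exceed
   L.  For a cut set C with j edges all of whose minimal cut sets are trivial,
   the sets U with d(U) inside C and |U| <= L are the unions of the components
   of G - C other than a giant one, and those components are trees; toggling one
   of them changes the sign of (-1)^(|U| + |E(U) - C|), so the signed sum over
   the nonempty U is -1.  It is 0 if C is not a cut set or is a non-trivial
   minimal one.  Summing over C and exchanging the sums leaves a quantity that
   depends only on the numbers of w-sets U with i inner edges, w <= L.  Those
   numbers are the same for all k-regular graphs of girth greater than L, because
   injective homomorphisms of forests can be counted by removing leaves. *)

Require Import Defs.
From mathcomp Require Import all_boot.
From mathcomp Require Import all_algebra zify.

Set Implicit Arguments.
Unset Strict Implicit.
Unset Printing Implicit Defensive.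

Import GRing.Theory.

(** * Edges, boundaries and cut sets *)

Lemma set2_eq (T : finType) (a b x y : T) :
  [set a; b] = [set x; y] -> (a = x /\ b = y) \/ (a = y /\ b = x).
Proof.
move=> E.
have /set2P[ax|ay] : a \in [set x; y] by rewrite -E set21.
  have /set2P[ya|yb] : y \in [set a; b] by rewrite E set22.
    have /set2P[bx|by_] : b \in [set x; y] by rewrite -E set22.
      by left; split=> //; rewrite bx ya.
    by left.
  by left; split.
have /set2P[xa|xb] : x \in [set a; b] by rewrite E set21.
  have /set2P[bx|by_] : b \in [set x; y] by rewrite -E set22.
    by right.
  by right; split=> //; rewrite by_ xa.
by right.
Qed.

Lemma leq_bigmin (I : eqType) (r : seq I) (P : pred I) (F : I -> nat) a i :
  i \in r -> P i -> \big[minn/a]_(j <- r | P j) F j <= F i.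
Proof.
elim: r => // j r IH; rewrite inE big_cons => /orP[/eqP <- -> | ir Pi].
  exact: geq_minl.
case: ifP => _; last exact: IH.
by rewrite (leq_trans (geq_minr _ _)) ?IH.
Qed.

Section Graph.
Variables (n m : nat) (G : mgraph n m).
Implicit Types (e : 'I_m) (S U X Y Z D : {set 'I_n}) (C F : {set 'I_m}).

Lemma ends_pairP e : exists p, ends G e == [set p.1; p.2].
Proof.
have /forallP/(_ e)/andP[] := valP G; rewrite -/(ends G e) => h0 h2.
have [/cards1P[x ->] | /cards2P[x [y [_ ->]]]] :
    #|ends G e| == 1 \/ #|ends G e| == 2.
- by case: #|_| h0 h2 => [|[|[]]] //; [left|right].
- by exists (x, x); rewrite /= setUid.
- by exists (x, y).
Qed.

(** An arbitrary orientation of the edges, a loop having equal end points. Membership in a boundary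
    becomes an exclusive or, which is false on loops. *)
Definition src e := (xchoose (ends_pairP e)).1.
Definition tgt e := (xchoose (ends_pairP e)).2.

Lemma endsE e : ends G e = [set src e; tgt e].
Proof. exact/eqP/(xchooseP (ends_pairP e)). Qed.

Lemma ends_src_tgt e x y : ends G e = [set x; y] ->
  (src e = x /\ tgt e = y) \/ (src e = y /\ tgt e = x).
Proof. by rewrite endsE => /set2_eq. Qed.

Definition inner S : {set 'I_m} := [set e | (src e \in S) && (tgt e \in S)].

Lemma in_inner S e : (e \in inner S) = (src e \in S) && (tgt e \in S).
Proof. by rewrite inE. Qed.

Lemma in_boundary S e : (e \in boundary G S) = (src e \in S) (+) (tgt e \in S).
Proof.
rewrite inE; apply/existsP/idP => [[x /andP[xS /existsP[y /andP[yS /eqP]]]]|].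
  rewrite inE in yS; rewrite endsE => /set2_eq[] [-> ->].
    by rewrite xS (negbTE yS).
  by rewrite xS (negbTE yS).
case: (boolP (src e \in S)) => s_S /= t_S.
  exists (src e); rewrite s_S; apply/existsP; exists (tgt e).
  by rewrite inE t_S endsE eqxx.
exists (tgt e); rewrite t_S; apply/existsP; exists (src e).
by rewrite inE s_S endsE setUC eqxx.
Qed.

Lemma boundaryC S : boundary G (~: S) = boundary G S.
Proof. by apply/setP => e; rewrite !in_boundary !inE addbN addNb negbK. Qed.

Lemma boundary0 : boundary G set0 = set0.
Proof. by apply/setP => e; rewrite in_boundary !inE. Qed.

Definition symdiff (T : finType) (A B : {set T}) := [set x | (x \in A) (+) (x \in B)].

Lemma boundary_symdiff S U :
  boundary G (symdiff S U) = symdiff (boundary G S) (boundary G U).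
Proof.
apply/setP => e; rewrite [RHS]in_set !in_boundary !in_set.
by do 4 case: (_ \in _).
Qed.

Lemma boundaryU S U : boundary G (S :|: U) \subset boundary G S :|: boundary G U.
Proof.
by apply/subsetP => e; rewrite in_setU !in_boundary !inE; do 4 case: (_ \in _).
Qed.

Lemma boundaryI S U : boundary G (S :&: U) \subset boundary G S :|: boundary G U.
Proof.
by apply/subsetP => e; rewrite in_setU !in_boundary !inE; do 4 case: (_ \in _).
Qed.

Lemma inner_sub S U : S \subset U -> inner S \subset inner U.
Proof.
move=> /subsetP SU; apply/subsetP => e; rewrite !in_inner => /andP[a b].
by rewrite !SU.
Qed.

Lemma boundary_inner_disjoint S U : S \subset U -> [disjoint boundary G U & inner S].
Proof.
move=> /subsetP SU; apply/pred0P => e /=; rewrite in_boundary in_inner.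
by case: (boolP (src e \in S)) => [/SU ->|_]; rewrite ?andbF //=;
   case: (boolP (tgt e \in S)) => [/SU ->|_]; rewrite ?andbF.
Qed.

Lemma degreeE x : degree G x = \sum_e ((src e == x) + (tgt e == x)).
Proof.
rewrite /degree -!sum1_card [X in X + _]big_mkcond [X in _ + X]big_mkcond.
rewrite -big_split /=; apply: eq_bigr => e _;
  rewrite !inE endsE !inE (eq_sym (src e)) (eq_sym (tgt e)).
have -> : ([set src e; tgt e] == [set x]) = (x == src e) && (x == tgt e).
  apply/eqP/andP => [E|[/eqP <- /eqP <-]]; last by rewrite setUid.
  have := set21 (src e) (tgt e); have := set22 (src e) (tgt e).
  by rewrite E !inE => /eqP -> /eqP ->.
by do 2 case: (_ == _).
Qed.

Lemma sum_degree S : \sum_(x in S) degree G x = 2 * #|inner S| + #|boundary G S|.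
Proof.
under eq_bigr do rewrite degreeE.
rewrite exchange_big /= -2!sum1_card [X in 2 * X]big_mkcond [X in _ + X]big_mkcond /=.
rewrite big_distrr -big_split; apply: eq_bigr => e _ /=.
have E z : \sum_(x in S) (z == x) = (z \in S).
  case: (boolP (z \in S)) => zS.
    rewrite (bigD1 z) //= eqxx big1 // => y /andP[_].
    by rewrite eq_sym => /negbTE ->.
  by rewrite big1 // => y yS; case: eqP => // zy; rewrite zy yS in zS.
by rewrite big_split /= !E in_inner in_boundary; do 2 case: (_ \in _).
Qed.

Lemma regular_boundary k S : regular k G ->
  k * #|S| = 2 * #|inner S| + #|boundary G S|.
Proof.
move=> /forallP reg; rewrite -sum_degree.
by under eq_bigr => x _ do rewrite (eqP (reg x)); rewrite sum_nat_const mulnC.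
Qed.

(** Connecting [X] takes at least [#|X| - 1] edges. A largest [Y] around a fixed vertex with
    [#|Y| <= #|F :&: inner Y| + 1] works: an edge of [F] inside [X] that leaves [Y] would let [Y]
    absorb one more vertex along with that edge. *)
Lemma split_few_edges F X : X != set0 ->
  #|F :&: inner X| + 1 < #|X| ->
  exists Y, [/\ Y != set0, Y \proper X &
    forall e, e \in F :&: inner X -> e \notin boundary G Y].
Proof.
move=> /set0Pn[x xX] few.
pose P Y := [&& x \in Y, Y \subset X & #|Y| <= #|F :&: inner Y| + 1].
have P1 : P [set x] by rewrite /P set11 sub1set xX cards1 addn1.
case: (@arg_maxnP _ [set x] P (fun Y => #|Y|) P1) => Y /and3P[xY YX cY] Ymax.
exists Y; split.
- by apply/set0Pn; exists x.
- rewrite properE YX; apply: contraL few => XY.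
  have -> : X = Y by apply/eqP; rewrite eqEsubset XY.
  by rewrite -leqNgt.
move=> e; rewrite inE => /andP[eF]; rewrite in_inner => /andP[sX tX].
apply/negP; rewrite in_boundary => cross.
have grow y : y \in X -> y \notin Y ->
    (src e \in y |: Y) -> (tgt e \in y |: Y) -> False.
  move=> yX yY s_y t_y.
  have /Ymax : P (y |: Y).
    rewrite /P !inE xY orbT /= subUset sub1set yX YX /= cardsU1 yY /=.
    have : e |: (F :&: inner Y) \subset F :&: inner (y |: Y).
      rewrite subUset sub1set !inE eF; move: s_y t_y; rewrite !inE => -> -> /=.
      by apply: setIS; apply: inner_sub; apply: subsetUr.
    move/subset_leq_card; rewrite cardsU1.
    have -> : e \notin F :&: inner Y.
      by rewrite !inE; move: cross; do 2 case: (_ \in Y); rewrite ?andbF.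
    rewrite add1n => lt_F; rewrite addn1.
    by rewrite ltnS (leq_trans cY) // addn1.
  by rewrite /geq /= cardsU1 yY add1n ltnn.
case: (boolP (src e \in Y)) cross => sY /= tY.
  by apply: (grow (tgt e)); rewrite // !inE ?eqxx ?sY ?orbT.
apply: (grow (src e)); rewrite // !inE ?eqxx //.
by rewrite tY orbT.
Qed.

Lemma boundary_closed_connect F S x y :
  [disjoint F & boundary G S] -> connect (adj G F) x y -> (x \in S) = (y \in S).
Proof.
move=> dis /connectP[p]; elim: p x => [x _ -> // | z p IH x /= /andP[xz pz] yE].
rewrite -(IH _ pz yE); case/existsP: xz => e /andP[eF /eqP E].
have := disjointFr dis eF; rewrite in_boundary.
by case: (ends_src_tgt E) => [] [-> ->]; do 2 case: (_ \in S).
Qed.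

Lemma cut_setP C : 0 < n ->
  reflect (exists S, [/\ S != set0, S != setT & boundary G S \subset C])
          (cut_set G C).
Proof.
move=> n_gt0; have T0 : [set: 'I_n] != set0.
  by apply/set0Pn; exists (Ordinal n_gt0).
apply: (iffP idP); rewrite /cut_set /connected T0 /=.
  rewrite negb_forall => /existsP[x]; rewrite inE negb_forall => /existsP[y].
  rewrite inE => xy; exists [set z | connect (adj G (~: C)) x z]; split.
  - by apply/set0Pn; exists x; rewrite inE.
  - apply: contra xy => /eqP/setP/(_ y); by rewrite !inE => ->.
  apply/subsetP => e; rewrite inE => /existsP[a /andP[]].
  rewrite inE => xa /existsP[b /andP[]]; rewrite !inE => xb E.
  apply: contraR xb => eC; apply: connect_trans xa (connect1 _).
  by apply/existsP; exists e; rewrite inE eC.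
case=> S [/set0Pn[x xS] ST SC].
have [y yS] : exists y, y \notin S.
  apply/existsP; apply: contraR ST; rewrite negb_exists => /forallP allS.
  by apply/eqP/setP => y; rewrite inE (negbNE (allS y)).
apply/negP => /forallP/(_ x); rewrite inE => /forallP/(_ y); rewrite inE => xy.
have dis : [disjoint ~: C & boundary G S].
  by rewrite disjoint_sym disjoints_subset setCK.
by have := boundary_closed_connect dis xy; rewrite xS (negbTE yS).
Qed.

End Graph.

(** * Short cycles *)

(** A repetition inside the window is itself a shorter return, so strong induction on [d] ends at a
    window without repetitions. *)
Lemma first_return (T : eqType) (x : nat -> T) i d :
  0 < d -> x i = x (i + d) ->
  exists j l, [/\ 0 < l, x j = x (j + l) &
    forall a b, a < l -> b < l -> x (j + a) = x (j + b) -> a = b].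
Proof.
elim/ltn_ind: d i => d IH i d_gt0 xd.
have [inj|] := boolP (uniq [seq x (i + a) | a <- iota 0 d]).
  exists i, d; split=> // a b ad bd E; apply/eqP.
  rewrite -(nth_uniq (x i) _ _ inj) ?size_map ?size_iota //.
  by rewrite !(nth_map 0) ?size_iota // !nth_iota // E.
move=> /(uniqPn (x i))[a [b [ab]]]; rewrite size_map size_iota => bd.
rewrite !(nth_map 0) ?size_iota ?(ltn_trans ab) // !nth_iota ?(ltn_trans ab) //.
rewrite !add0n => E.
by apply: (IH (b - a) _ (i + a)); rewrite ?subn_gt0 // ?E; try congr x; lia.
Qed.

Section Girth.
Variables (n m : nat) (G : mgraph n m).
Implicit Types (e : 'I_m) (S U X Y Z D : {set 'I_n}) (C F : {set 'I_m}).

Lemma nonbacktracking_cycle S (xs : nat -> 'I_n) (es : nat -> 'I_m) :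
  (forall i, xs i \in S) ->
  (forall i, ends G (es i) = [set xs i; xs i.+1]) ->
  (forall i, es i.+1 != es i) ->
  exists2 l, has_cycle G setT l & l <= #|S|.
Proof.
move=> xS xE nb.
have [i [d [d_gt0 ret]]] : exists i d, 0 < d /\ xs i = xs (i + d).
  have /injectivePn[a [b ab E]] : ~~ injectiveb (fun i : 'I_n.+1 => xs i).
    by apply/negP => /injectiveP/leq_card; rewrite !card_ord ltnn.
  have [lt_ab|lt_ba|eq_ab] := ltngtP (val a) (val b).
  - by exists a, (b - a); rewrite subn_gt0 subnKC // ltnW.
  - by exists b, (a - b); rewrite subn_gt0 subnKC // ltnW.
  - by move: ab; rewrite (val_inj eq_ab) eqxx.
have {i d d_gt0 ret} [i [l [l_gt0 ret inj]]] := first_return d_gt0 ret.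
have xsS (a : 'I_l) : xs (i + ordS a) = xs (i + a).+1.
  rewrite /=; have [lt|] := ltnP a.+1 l; first by rewrite modn_small // addnS.
  move=> ge; have -> : a.+1 = l by apply/eqP; rewrite eqn_leq ge ltn_ord.
  rewrite modnn addn0 ret; congr xs; have := ltn_ord a; lia.
exists l; last first.
  have : [set xs (i + a) | a : 'I_l] \subset S.
    by apply/subsetP => _ /imsetP[a _ ->].
  move/subset_leq_card; rewrite card_imset ?card_ord // => a b E.
  by apply: ord_inj; apply: inj.
rewrite /has_cycle l_gt0 /=; apply/existsP; exists [ffun a : 'I_l => xs (i + a)].
apply/existsP; exists [ffun a : 'I_l => es (i + a)]; apply/and3P; split.
- by apply/injectiveP => a b; rewrite !ffunE => E; apply: ord_inj; apply: inj.
(* Equal edges have equal ends, so they start at the same vertex or each starts where the other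
   stops. In the second case their positions differ by one, against [nb], or the cycle has length
   1. *)
- apply/injectiveP => a b; rewrite !ffunE => E.
  have := xE (i + a); rewrite E xE -!xsS => /set2_eq[[ab _]|[ba ab]].
    by apply/esym/ord_inj; apply: inj.
  have {}ba := inj _ _ (ltn_ord b) (ltn_ord (ordS a)) ba.
  have {}ab := inj _ _ (ltn_ord (ordS b)) (ltn_ord a) ab.
  move: ab ba => /=.
  have [lt|gea] := ltnP a.+1 l.
    rewrite (modn_small lt) => _ ba; have := nb (i + a).
    by rewrite E ba addnS eqxx.
  have al : a.+1 = l by apply/eqP; rewrite eqn_leq gea ltn_ord.
  rewrite al modnn => ab b0; have [lt|geb] := ltnP b.+1 l.
    rewrite (modn_small lt) in ab; have := nb (i + b).
    by rewrite -E -ab addnS eqxx.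
  by apply: val_inj; rewrite /= b0; move: al geb; rewrite b0; lia.
- by apply/forallP => a; rewrite !ffunE inE xE -xsS eqxx.
Qed.

(** In a smallest dense set without loops every vertex meets at least two inner edges, since
    deleting a vertex that meets fewer leaves a smaller dense set. One can therefore walk inside it
    forever without backtracking. *)
Lemma dense_has_cycle S : S != set0 -> #|S| <= #|inner G S| ->
  exists2 l, has_cycle G setT l & l <= #|S|.
Proof.
move=> S0 dense; pose P S := (S != set0) && (#|S| <= #|inner G S|).
have {S0 dense} PS : P S by rewrite /P S0.
have [X [/andP[X0 dense] Xmin]] :
    exists X, P X /\ forall Y, P Y -> #|X| <= #|Y|.
  by case: (@arg_minnP _ S P (fun S => #|S|) PS) => X PX Xmin; exists X.
suff [l cyc lX] : exists2 l, has_cycle G setT l & l <= #|X|.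
  by exists l; rewrite // (leq_trans lX) // Xmin.
have [/existsP[e /andP[eX /eqP loop]]|noloop] :=
    boolP [exists e in inner G X, src G e == tgt G e].
  exists 1; last by rewrite card_gt0.
  rewrite /has_cycle /=; apply/existsP; exists [ffun=> src G e].
  apply/existsP; exists [ffun=> e]; apply/and3P; split.
  - by apply/injectiveP => a b; rewrite !ord1.
  - by apply/injectiveP => a b; rewrite !ord1.
  - by apply/forallP => a; rewrite !ffunE inE endsE -loop eqxx.
pose inc x := [set e in inner G X | (src G e == x) || (tgt G e == x)].
have inc2 x : x \in X -> 1 < #|inc x|.
  move=> xX; rewrite ltnNge; apply/negP => inc1.
  have X1 : X :\ x != set0.
    apply: contra noloop => /eqP X1.
    have EX : X = [set x].
      by rewrite -(setD1K xX) X1 setU0.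
    have /set0Pn[e eX] : inner G X != set0.
      by rewrite -card_gt0 (leq_trans _ dense) // card_gt0.
    apply/existsP; exists e; rewrite eX; move: eX.
    by rewrite EX in_inner !inE => /andP[/eqP -> /eqP ->] /=.
  have /Xmin : P (X :\ x).
    rewrite /P X1 /=; have -> : inner G (X :\ x) = inner G X :\: inc x.
      apply/setP => e; rewrite in_setD [e \in inc x]in_set !in_inner !in_setD1.
      by do 2 case: (_ == x); do 2 case: (_ \in X).
    rewrite (cardsD (inner G X));
      have := subset_leq_card (subsetIr (inner G X) (inc x)).
    have := cardsD1 x X; rewrite xX add1n; move: dense inc1.
    move: #|inner G X :&: inc x| #|inc x| #|inner G X| #|X :\ x| #|X| => c i a d b.
    lia.
  by rewrite (cardsD1 x X) xX add1n ltnn.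
(* A state of the walk is a vertex with the edge about to be crossed. The default in [next] never
   occurs, by [inc2]. *)
pose other x e := if src G e == x then tgt G e else src G e.
pose next y e := odflt e [pick e' in inc y | e' != e].
pose step p := (other p.1 p.2, next (other p.1 p.2) p.2).
pose inv p := (p.1 \in X) && (p.2 \in inc p.1).
have stepP p : inv p -> [/\ inv (step p),
    ends G p.2 = [set p.1; (step p).1] & (step p).2 != p.2].
  case: p => x e /andP[/= xX]; rewrite inE in_inner => /andP[/andP[sX tX] xe].
  have E : ends G e = [set x; other x e].
    rewrite endsE /other; case: eqP xe => /= [-> //|_ /eqP ->].
    by rewrite setUC.
  have oX : other x e \in X by rewrite /other; case: ifP.
  rewrite /inv /step /= oX E /next; case: pickP => /= [e' /andP[-> ->] //|none].
  have := inc2 _ oX; rewrite ltnNge => /negP[].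
  rewrite -(cards1 e) subset_leq_card //; apply/subsetP => e' He'.
  by have := none e'; rewrite He' inE => /= /negbFE.
have [x xX] := set0Pn _ X0.
have /set0Pn[e ex] : inc x != set0 by rewrite -card_gt0 ltnW ?inc2.
pose st i := iter i step (x, e).
have st_inv i : inv (st i).
  by elim: i => [|i /stepP[]//]; rewrite /inv /= xX.
apply: (@nonbacktracking_cycle X (fun i => (st i).1) (fun i => (st i).2)) => i.
- by have /andP[] := st_inv i.
- by have [] := stepP _ (st_inv i).
- by have [] := stepP _ (st_inv i).
Qed.

Lemma has_cycle_leq F l : has_cycle G F l -> l <= n.
Proof.
case/andP=> _ /existsP[v /existsP[c /and3P[/injectiveP inj _ _]]].
by have := leq_card v inj; rewrite !card_ord.
Qed.

Lemma girth_leq l : has_cycle G setT l -> girth G <= l.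
Proof.
move=> cyc; have ln := has_cycle_leq cyc.
rewrite -ltnS in ln.
exact: (@leq_bigmin _ _ (fun l : 'I_n.+1 => has_cycle G setT l) _ n.+1
   (Ordinal ln) (mem_index_enum _) cyc).
Qed.

Lemma girth_cycle : girth G <= n -> has_cycle G setT (girth G).
Proof.
rewrite /girth; elim/big_ind: _ => [|a b Ha Hb|i //]; first by rewrite ltnn.
by rewrite minnE; case: (leqP a b) => ab;
   [rewrite (eqP ab) subn0|rewrite subKn // ltnW].
Qed.

Lemma girth_sparse S : S != set0 -> #|S| < girth G -> #|inner G S| < #|S|.
Proof.
move=> S0 Sg; rewrite ltnNge; apply/negP => /(dense_has_cycle S0)[l cyc lS].
by have := leq_trans (girth_leq cyc) lS; rewrite leqNgt Sg.
Qed.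

(** The vertex set of a shortest cycle. *)
Lemma girth_dense : girth G <= n ->
  exists Z, [/\ Z != set0, #|Z| = girth G & #|Z| <= #|inner G Z|].
Proof.
move=> /girth_cycle/andP[g0 /existsP[v /existsP[c /and3P[/injectiveP vi /injectiveP ci]]]].
move=> /forallP vc; exists (v @: setT).
have cZ : #|v @: setT| = girth G by rewrite card_imset // cardsT card_ord.
split; rewrite -?card_gt0 cZ //.
rewrite -[X in X <= _]card_ord -(card_imset _ ci).
apply/subset_leq_card/subsetP => _ /imsetP[a _ ->].
have /andP[_ /eqP E] := vc a; rewrite in_inner.
by case: (ends_src_tgt E) => [] [-> ->]; rewrite !imset_f.
Qed.
End Girth.

(** * Minimal cut sets and girth *)

Section Cuts.
Variables (n m : nat) (G : mgraph n m).
Implicit Types (e : 'I_m) (S U X Y Z D : {set 'I_n}) (C F : {set 'I_m}).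
(** An edge-count form of the property that [S] induces a forest. *)
Definition sparse S := [forall Y : {set 'I_n},
  (Y != set0) && (Y \subset S) ==> (#|inner G Y| < #|Y|)].

Lemma sparseP S : reflect
  (forall Y, Y != set0 -> Y \subset S -> #|inner G Y| < #|Y|) (sparse S).
Proof.
apply: (iffP forallP) => [H Y Y0 YS | H Y].
  by have := H Y; rewrite Y0 YS.
by apply/implyP => /andP[]; apply: H.
Qed.

Lemma girth_sparse_set S : #|S| < girth G -> sparse S.
Proof.
move=> Sg; apply/sparseP => Y Y0 YS; apply: girth_sparse => //.
by rewrite (leq_ltn_trans _ Sg) ?subset_leq_card.
Qed.

(** A forest on [S] has at most [#|S| - 1] edges, and the degree sum turns this into a lower bound
    on the boundary, attained by trees. *)
Lemma sparse_boundary k S : 2 < k -> regular k G -> S != set0 -> sparse S ->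
  #|S| * (k - 2) + 2 <= #|boundary G S|.
Proof.
move=> k3 reg S0 /sparseP/(_ S S0 (subxx _)).
by have := regular_boundary S reg; nia.
Qed.

(** [Z] is a smallest dense subset of [S]. If no inner edge of [Z] crossed from a nonempty [Z :&: D]
    to a nonempty [Z :\: D], both parts would be sparse and [Z] would have too few edges. *)
Lemma nonsparse_core S : ~~ sparse S ->
  exists Z, [/\ Z \subset S, Z != set0, girth G <= #|Z| &
    forall D, [disjoint boundary G D & inner G Z] ->
      Z \subset D \/ [disjoint Z & D]].
Proof.
rewrite negb_forall => /existsP[Y0]; rewrite negb_imply -leqNgt.
pose P Y := [&& Y != set0, Y \subset S & #|Y| <= #|inner G Y|].
rewrite -andbA => PY0.
have [Z [/and3P[Z0 ZS dense] Zmin]] :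
    exists Z, P Z /\ forall Y, P Y -> #|Z| <= #|Y|.
  by case: (@arg_minnP _ Y0 P (fun S => #|S|) PY0) => X PX Xmin; exists X.
exists Z; split=> //.
  rewrite leqNgt; apply/negP => /(girth_sparse Z0).
  by rewrite ltnNge dense.
move=> D dis.
have [ZD|ZD] := eqVneq (Z :\: D) set0.
  by left; rewrite -setD_eq0 ZD.
have [ZI|ZI] := eqVneq (Z :&: D) set0.
  by right; rewrite -setI_eq0 ZI.
have small Y : Y != set0 -> Y \proper Z -> #|inner G Y| < #|Y|.
  move=> Yn0 YZ; rewrite ltnNge; apply/negP => dY.
  have /Zmin : P Y by rewrite /P Yn0 dY (subset_trans (proper_sub YZ)).
  by rewrite leqNgt proper_card.
have s1 : #|inner G (Z :&: D)| < #|Z :&: D|.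
  apply: small => //; rewrite properE subsetIl /=; apply: contra ZD.
  by rewrite subsetI => /andP[_]; rewrite -setD_eq0.
have s2 : #|inner G (Z :\: D)| < #|Z :\: D|.
  apply: small => //; rewrite properE subsetDl /=; apply: contra ZI.
  by rewrite subsetD setI_eq0 => /andP[].
have : inner G Z \subset inner G (Z :&: D) :|: inner G (Z :\: D).
  apply/subsetP => e eZ; have := disjointFl dis eZ; move: eZ.
  rewrite in_setU !in_inner in_boundary !in_setI !in_setD.
  by do 4 case: (_ \in _).
move/subset_leq_card => le_inner; exfalso.
have := leq_trans le_inner (leq_card_setU _ _); apply/negP; rewrite -ltnNge.
apply: leq_trans dense; rewrite -(cardsID D Z) -addSn leq_add //.
exact: ltnW.
Qed.

Lemma trivial_cut_tree C : trivial_cut_set G C ->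
  exists S, [/\ S != set0, #|S| < girth G & boundary G S = C].
Proof.
case/andP=> _ /existsP[S /existsP[F /and3P[/and3P[_ /andP[S0 _] _] Sg /eqP E]]].
exists S; split=> //.
(* At girth 0 the truncated predecessor is again 0, but then [S] would be empty. *)
case: (girth G) Sg => [|h]; last by rewrite ltnS.
by move=> /= Sle; move: S0; rewrite -card_gt0 => /leq_trans/(_ Sle).
Qed.

Hypothesis n_gt0 : 0 < n.
Hypothesis conn : ~~ cut_set G set0.

Lemma boundary_eq0 S : boundary G S = set0 -> S = set0 \/ S = setT.
Proof.
move=> S0; have [->|Sn0] := eqVneq S set0; first by left.
have [->|SnT] := eqVneq S setT; first by right.
by case/negP: conn; apply/cut_setP => //; exists S; rewrite S0 sub0set.
Qed.

(** The symmetric difference of the two sets has empty boundary, so connectedness leaves it empty or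
    full. *)
Lemma boundary_inj S U :
  boundary G S = boundary G U -> U = S \/ U = ~: S.
Proof.
move=> E; have : boundary G (symdiff S U) = set0.
  by rewrite boundary_symdiff E; apply/setP => e; rewrite !in_set addbb.
case/boundary_eq0 => /setP H; [left|right]; apply/setP => x;
  by have := H x; rewrite !in_set; do 2 case: (_ \in _).
Qed.

Lemma minimal_cutP C : minimal_cut_set G C ->
  exists S, [/\ S != set0, S != setT & boundary G S = C].
Proof.
case/minsetP => /(cut_setP _ _ n_gt0)[S [S0 ST SC]] minC; exists S; split=> //.
by apply: minC SC; apply/cut_setP => //; exists S.
Qed.

(** Minimality of the cut set makes the side [S] connected, and an order below the girth makes it
    acyclic. Being trivial thus depends only on the order of a side. *)
Lemma trivial_cutP C : minimal_cut_set G C ->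
  reflect (exists S, [/\ S != set0, #|S| < girth G & boundary G S = C])
          (trivial_cut_set G C).
Proof.
move=> minC; apply: (iffP idP) => [/trivial_cut_tree //|].
case=> S [S0 Sg E]; rewrite /trivial_cut_set minC; apply/existsP; exists S;
  apply/existsP; exists (inner G S).
rewrite E eqxx andbT; apply/andP; split; last by move: Sg; lia.
apply/and3P; split.
- apply/forall_inP => e; rewrite in_inner => /andP[sS tS].
  by rewrite endsE subUset !sub1set sS.
- rewrite /connected S0; apply/forall_inP => x xS; apply/forall_inP => y yS.
  apply/negPn/negP => xy.
  (* The boundary of the component [U] of [x] in [S] lies in that of [S], so the two agree by
     minimality. Then [U] is [S] or its complement, but it contains [x] and not [y]. *)
  pose U := [set z in S | connect (adj G (inner G S)) x z].
  have UE : boundary G U \subset boundary G S.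
    apply/subsetP => e; rewrite inE => /existsP[a /andP[]].
    rewrite inE => /andP[aS xa] /existsP[b /andP[]]; rewrite !inE => bU E'.
    rewrite -/(boundary G S); apply/existsP; exists a; rewrite aS.
    apply/existsP; exists b; rewrite E' inE andbT; apply: contra bU => bS.
    rewrite bS (connect_trans xa) // connect1 //; apply/existsP; exists e.
    rewrite E' andbT in_inner.
    by case: (ends_src_tgt (eqP E')) => [] [-> ->]; rewrite ?aS ?bS.
  have xU : x \in U by rewrite inE xS connect0.
  have yU : y \notin U by rewrite inE yS.
  have EU : boundary G U = C.
    rewrite -E in minC *; case/minsetP: minC => _; apply=> //.
    apply/cut_setP => //; exists U; split=> //.
      by apply/set0Pn; exists x.
    by apply: contraNneq yU => ->; rewrite inE.
  case: (@boundary_inj S U); rewrite ?EU // => UEq.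
    by rewrite UEq yS in yU.
  by move: xU; rewrite UEq inE xS.
- apply/existsP => -[l /andP[l0 /existsP[v /existsP[c /and3P[vi ci vc]]]]].
  have lg : girth G <= l.
    apply: girth_leq; rewrite /has_cycle l0; apply/existsP; exists v.
    apply/existsP; exists c; rewrite vi ci; apply/forallP => i.
    by have /forallP/(_ i)/andP[_ ->] := vc; rewrite inE.
  have : [set v i | i : 'I_l] \subset S.
    apply/subsetP => _ /imsetP[i _ ->].
    have /forallP/(_ i)/andP[] := vc; rewrite in_inner => /andP[sS tS] /eqP E'.
    by case: (ends_src_tgt E') => [[<- _]|[_ <-]].
  move/subset_leq_card; rewrite card_imset; last exact/injectiveP.
  by rewrite card_ord leqNgt (leq_trans Sg).
Qed.

(* If both sides contain a dense core, Z1 and Z2, a set D separating them with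
   d(D) inside d(U) and as small as possible has a minimal cut set as boundary:
   for another E with d(E) properly inside d(D), either E itself, its complement,
   or the symmetric difference of D with one of them would do better.  Such a cut
   set is not trivial, since both of its sides have at least girth many vertices. *)
Lemma sparse_or_sparseC U :
  (forall C, minimal_cut_set G C -> C \subset boundary G U ->
     trivial_cut_set G C) ->
  sparse U \/ sparse (~: U).
Proof.
move=> triv; have [|/nonsparse_core[Z1 [Z1U Z10 Z1g Z1c]]] := boolP (sparse U).
  by left.
have [|/nonsparse_core[Z2 [Z2U Z20 Z2g Z2c]]] := boolP (sparse (~: U)).
  by right.
pose P D := [&& Z1 \subset D, Z2 \subset ~: D & boundary G D \subset boundary G U].
have PU : P U by rewrite /P Z1U Z2U subxx.
have [D [/and3P[Z1D Z2D DU] Dmin]] :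
    exists D, P D /\ forall E, P E -> #|boundary G D| <= #|boundary G E|.
  case: (@arg_minnP _ U P (fun S => #|boundary G S|) PU) => X PX Xmin.
  by exists X.
have cutD E : E != set0 -> E != setT -> boundary G E \subset boundary G D ->
    boundary G E = boundary G D.
  wlog : E / Z1 \subset E => [wl|Z1E] E0 ET ED.
    have disE : [disjoint boundary G E & inner G Z1].
      apply: disjointWl (boundary_inner_disjoint G Z1U).
      exact: subset_trans ED DU.
    have [Z1E|dis] := Z1c E disE; first exact: wl.
    rewrite -boundaryC; apply: wl; rewrite ?boundaryC //.
    - by rewrite -disjoints_subset.
    - by apply: contra ET => /eqP E'; rewrite -(setCK E) E' setC0.
    - by apply: contra E0 => /eqP E'; rewrite -(setCK E) E' setCT.
  have disE : [disjoint boundary G E & inner G Z2].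
    apply: disjointWl (boundary_inner_disjoint G Z2U); rewrite boundaryC.
    exact: subset_trans ED DU.
  have [Z2E|Z2E] := Z2c E disE.
  (* Since [E] contains both cores, this set still separates them. Its boundary is that of [D] minus
     that of [E], so by the choice of [D] the boundary of [E] is empty. *)
  - have : P (symdiff D (~: E)).
      apply/and3P; split.
      + apply/subsetP => x xZ; rewrite !in_set.
        by rewrite (subsetP Z1D) ?(subsetP Z1E).
      + apply/subsetP => x xZ; rewrite !in_set.
        by have := subsetP Z2D x xZ; rewrite in_setC => /negbTE ->;
           rewrite (subsetP Z2E).
      + rewrite boundary_symdiff boundaryC; apply/subsetP => e; rewrite in_set.
        by case: (boolP (e \in boundary G E)) => [/(subsetP ED) ->|_];
           rewrite // addbF => /(subsetP DU).
    move/Dmin; rewrite boundary_symdiff boundaryC.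
    have -> : symdiff (boundary G D) (boundary G E) = boundary G D :\: boundary G E.
      apply/setP => e; rewrite in_set in_setD.
      by case: (boolP (e \in boundary G E)) => [/(subsetP ED) ->|_];
         rewrite // addbF.
    rewrite cardsD (setIidPr ED) => h.
    have : boundary G E = set0.
      apply/eqP; rewrite -cards_eq0 -leqn0.
      by rewrite -(subKn (subset_leq_card ED)) leq_subLR addn0.
    by case/boundary_eq0 => E'; rewrite E' eqxx in E0 ET.
  - apply/eqP; rewrite eqEcard ED Dmin //.
    by rewrite /P Z1E -disjoints_subset Z2E (subset_trans ED).
have minD : minimal_cut_set G (boundary G D).
  apply/minsetP; split.
    apply/cut_setP => //; exists D; split=> //.
      by apply: contraNneq Z10 => D0; rewrite D0 subset0 in Z1D.
    by apply: contraNneq Z20 => DT; rewrite DT setCT subset0 in Z2D.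
  move=> B /(cut_setP _ _ n_gt0)[E [E0 ET EB]] BD; apply/eqP.
  by rewrite eqEsubset BD -(cutD E) // (subset_trans EB).
have /(trivial_cutP minD)[S [_ Sg SD]] := triv _ minD DU.
have [SE|SE] := boundary_inj SD.
  by move: Z1g; rewrite leqNgt (leq_ltn_trans _ Sg) // -SE subset_leq_card.
rewrite SE setCK in Z2D.
by move: Z2g; rewrite leqNgt (leq_ltn_trans _ Sg) // subset_leq_card.
Qed.

(** Let h be the girth. The vertex set [Z] of a shortest cycle has at most h (k - 2) boundary edges
    and is not sparse, so its complement is. If n >= 2h, that forest would need more boundary edges
    than [Z] has. *)
Lemma short_girth_small_order k j : 2 < k -> regular k G ->
  (forall C, minimal_cut_set G C -> #|C| <= j -> trivial_cut_set G C) ->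
  girth G <= n -> girth G * (k - 2) <= j -> n < 2 * girth G.
Proof.
move=> k3 reg triv gn gj; have [Z [Z0 cZ dZ]] := girth_dense gn.
rewrite ltnNge; apply/negP => ng.
have bZ := regular_boundary Z reg.
have [|/sparseP/(_ Z Z0 (subxx _))|sp] := @sparse_or_sparseC Z.
- move=> C minC /subset_leq_card CZ; apply: triv => //.
  by rewrite (leq_trans CZ) // (leq_trans _ gj) //; nia.
- by rewrite ltnNge dZ.
have ZC0 : ~: Z != set0.
  rewrite -card_gt0; have := cardsC Z; rewrite card_ord.
  by move: Z0; rewrite -card_gt0; lia.
have := sparse_boundary k3 reg ZC0 sp; rewrite boundaryC.
by have := cardsC Z; rewrite card_ord; nia.
Qed.

End Cuts.

(** * The signed sum over unions of small components *)

Section LocalIdentity.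
Variables (n m k : nat) (G : mgraph n m).
Implicit Types (e : 'I_m) (S U X Y Z D : {set 'I_n}) (C F : {set 'I_m}).
Hypotheses (n_gt0 : 0 < n) (conn : ~~ cut_set G set0).
Hypotheses (k_gt2 : 2 < k) (reg : regular k G).

(** The exponent has the parity of the Euler characteristic of [U] in G - C, which for a union of
    tree components is their number. *)
Definition weight C U : int := ((-1) ^+ (#|U| + #|inner G U :\: C|))%R.

Lemma setU_symdiff (T : finType) (A B : {set T}) :
  [disjoint A & B] -> symdiff A B = A :|: B.
Proof.
move=> dis; apply/setP => x; rewrite !in_set.
by case: (boolP (x \in A)) => // /(disjointFr dis) ->.
Qed.

Lemma setD_symdiff (T : finType) (A B : {set T}) :
  B \subset A -> symdiff A B = A :\: B.
Proof.
move=> /subsetP BA; apply/setP => x; rewrite !in_set.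
by case: (boolP (x \in B)) => [/BA ->|_] //; rewrite addbF.
Qed.

Lemma symdiffK (T : finType) (B : {set T}) : involutive (fun A => symdiff A B).
Proof. by move=> A; apply/setP => x; rewrite !in_set -addbA addbb addbF. Qed.

Lemma symdiff_sub (T : finType) (A B C : {set T}) :
  A \subset C -> B \subset C -> symdiff A B \subset C.
Proof.
move=> /subsetP AC /subsetP BC; apply/subsetP => x; rewrite in_set.
by case: (boolP (x \in A)) => [/AC|_ /BC].
Qed.

(** An edge between [U] and [X] lies in the boundary of [X], hence in [C]; so the edges outside [C]
    split and the exponents add. *)
Lemma weightU C U X : boundary G X \subset C -> [disjoint U & X] ->
  weight C (U :|: X) = (weight C U * weight C X)%R.
Proof.
move=> XC dis; rewrite /weight -exprD; congr (_ ^+ _)%R.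
have -> : inner G (U :|: X) :\: C = (inner G U :\: C) :|: (inner G X :\: C).
  apply/setP => e; rewrite in_setU !in_setD !in_inner !in_setU.
  have := subsetP XC e; rewrite in_boundary.
  have := @disjointFr _ _ _ (src G e) dis; have := @disjointFr _ _ _ (tgt G e) dis.
  by do 2 case: (_ \in U) => [/(_ isT) ->|_]; case: (e \in C);
     do 2?case: (_ \in X) => //= /(_ isT).
rewrite (cardsU U X) (cardsU (inner G U :\: C));
  have -> : U :&: X = set0 by apply/eqP; rewrite setI_eq0.
have -> : (inner G U :\: C) :&: (inner G X :\: C) = set0.
  apply/setP => e; rewrite in_setI !in_setD !in_inner in_set0.
  by case: (boolP (src G e \in U)) => [/(disjointFr dis) ->|_]; rewrite /= ?andbF.
by rewrite !cards0 !subn0 addnACA.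
Qed.

(* Were U :|: X too large, its complement would be sparse by [sparse_or_sparseC],
   and then G - C would have too few edges. *)
Lemma card_union_bound C U X j L :
  (forall C', minimal_cut_set G C' -> C' \subset C -> trivial_cut_set G C') ->
  #|C| <= j -> j + n <= m + 1 ->
  (forall w, (w <= L) = (w * (k - 2) + 2 <= j)) ->
  2 * L < n -> L < girth G ->
  U != set0 -> X != set0 -> [disjoint U & X] -> #|U| <= L -> #|X| <= L ->
  boundary G U \subset C -> boundary G X \subset C -> #|U :|: X| <= L.
Proof.
move=> triv Cj jm Lj Ln Lg U0 X0 dis UL XL UC XC.
have YC : boundary G (U :|: X) \subset C.
  by apply: subset_trans (boundaryU G U X) _; rewrite subUset UC.
have Y0 : U :|: X != set0.
  by have [x xU] := set0Pn _ U0; apply/set0Pn; exists x; rewrite inE xU.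
have [|spY|spY] := @sparse_or_sparseC _ _ G n_gt0 conn (U :|: X).
- by move=> C' minC' /subset_trans/(_ YC); apply: triv.
- rewrite Lj (leq_trans (sparse_boundary k_gt2 reg Y0 spY)) //.
  by rewrite (leq_trans (subset_leq_card YC)).
have cY : #|U :|: X| = #|U| + #|X|.
  by rewrite cardsU (_ : U :&: X = set0) ?cards0 ?subn0 //; apply/eqP; rewrite setI_eq0.
have cYC := cardsC (U :|: X); rewrite card_ord in cYC.
have YC0 : ~: (U :|: X) != set0.
  by rewrite -card_gt0; rewrite cY in cYC; move: cYC Ln UL XL; lia.
have s1 : #|inner G U| < #|U| by apply: girth_sparse; rewrite ?(leq_ltn_trans UL).
have s2 : #|inner G X| < #|X| by apply: girth_sparse; rewrite ?(leq_ltn_trans XL).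
have s3 : #|inner G (~: (U :|: X))| < #|~: (U :|: X)| by apply: (sparseP _ _ spY).
have : ~: C \subset inner G U :|: (inner G X :|: inner G (~: (U :|: X))).
  apply/subsetP => e; rewrite in_setC => eC;
    rewrite !in_setU !in_inner !in_setC !in_setU.
  have := contra (subsetP UC e) eC; have := contra (subsetP XC e) eC.
  rewrite !in_boundary.
  by do 2 case: (_ \in U); do 2 case: (_ \in X).
move/subset_leq_card => le1.
have le2 := leq_card_setU (inner G X) (inner G (~: (U :|: X))).
have le3 := leq_card_setU (inner G U) (inner G X :|: inner G (~: (U :|: X))).
have cC := cardsC C; rewrite card_ord in cC.
case: le2 => le2 _; case: le3 => le3 _.
move: cY cYC s1 s2 s3 le1 le2 le3 cC Cj jm; clear.
set a := #|inner G U|; set b := #|inner G X|; set c := #|inner G (~: _)|.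
set d := #|_ :|: inner G _|; set f := #|inner G U :|: _|.
by move: a b c d f #|U :|: X| #|~: (U :|: X)| #|U| #|X| #|C| #|~: C| => *; lia.
Qed.

(** Minimality makes [X] connected in G - C: otherwise [split_few_edges] yields a smaller nonempty
    set with boundary in [C]. *)
Lemma component_edges C X :
  X != set0 -> boundary G X \subset C ->
  (forall Y, Y != set0 -> boundary G Y \subset C -> #|X| <= #|Y|) ->
  #|X| <= #|inner G X :\: C| + 1.
Proof.
move=> X0 XC Xmin; rewrite leqNgt; apply/negP.
have -> : inner G X :\: C = ~: C :&: inner G X by rewrite setIC setDE.
move/(split_few_edges X0) => [Y [Y0 YX noY]].
have /(Xmin _ Y0) : boundary G Y \subset C; last first.
  by rewrite leqNgt proper_card.
apply/subsetP => e eY; apply: contraLR eY => eC; have := contra (subsetP XC e) eC.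
rewrite in_boundary => eX.
have [eXX|] := boolP (e \in inner G X).
  by apply: noY; rewrite in_setI in_setC eC.
rewrite in_inner in_boundary; have /subsetP YX' := proper_sub YX.
have := YX' (src G e); have := YX' (tgt G e); move: eX.
case: (src G e \in X) => /=; case: (tgt G e \in X) => //= _ tX sX _.
by case: (src G e \in Y) sX => [/(_ isT)|_] //; case: (tgt G e \in Y) tX => // /(_ isT).
Qed.

(** A smallest nonempty [X] with boundary in [C] is a tree component of G - C, of weight -1. Any [U]
    with boundary in [C] contains or misses [X], so toggling [X] is a sign-reversing involution once
    the empty set is included. The full sum is therefore 0, and the empty set accounts for 1. *)
Lemma sum_weight_cut C j L :
  (forall C', minimal_cut_set G C' -> C' \subset C -> trivial_cut_set G C') ->
  cut_set G C -> #|C| <= j -> j + n <= m + 1 ->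
  (forall w, (w <= L) = (w * (k - 2) + 2 <= j)) ->
  2 * L < n -> L < girth G ->
  (\sum_(U : {set 'I_n} | (0 < #|U| <= L)%N && (boundary G U \subset C))
      weight C U = -1)%R.
Proof.
move=> triv cutC Cj jm Lj Ln Lg.
pose Q X := (X != set0) && (boundary G X \subset C).
have [S [QS SL]] : exists S, Q S /\ #|S| <= L.
  have [C' minC' C'C] := minset_exists cutC.
  have /(trivial_cutP n_gt0 conn minC')[S [S0 Sg SC']] := triv _ minC' C'C.
  exists S; rewrite /Q S0 SC' C'C; split=> //.
  rewrite Lj (leq_trans (sparse_boundary k_gt2 reg S0 (girth_sparse_set Sg))) //.
  by rewrite SC' (leq_trans (subset_leq_card C'C)).
have [X [/andP[X0 XC] Xmin]] : exists X, Q X /\ forall Y, Q Y -> #|X| <= #|Y|.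
  by case: (@arg_minnP _ S Q (fun S => #|S|) QS) => X QX Xmin; exists X.
have XL : #|X| <= L by apply: leq_trans SL; apply: Xmin.
have wX : weight C X = (-1)%R.
  have : #|X| = #|inner G X :\: C| + 1.
    apply/eqP; rewrite eqn_leq component_edges //; last first.
      by move=> Y Y0 YC; apply: Xmin; rewrite /Q Y0.
    rewrite addn1 (leq_ltn_trans (subset_leq_card (subsetDl _ _))) //.
    by apply: girth_sparse => //; apply: leq_ltn_trans Lg.
  rewrite /weight => ->; rewrite addnAC addnn exprD.
  by rewrite -signr_odd odd_double expr1 mul1r.
have Xcomp Y : boundary G Y \subset C -> X \subset Y \/ [disjoint Y & X].
  move=> YC; have [|XY] := eqVneq (Y :&: X) set0.
    by move/eqP; rewrite setI_eq0; right.
  left; have /Xmin : Q (Y :&: X).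
    rewrite /Q XY (subset_trans (boundaryI G Y X)) //.
    by rewrite subUset YC.
  move=> le; apply/setIidPr/eqP.
  by rewrite eqEcard subsetIr.
pose P U := (#|U| <= L) && (boundary G U \subset C).
have Ptog U : P U -> P (symdiff U X).
  case/andP=> UL UC; rewrite /P boundary_symdiff symdiff_sub // andbT.
  have [XU|dis] := Xcomp _ UC.
    by rewrite setD_symdiff // (leq_trans _ UL) // subset_leq_card ?subsetDl.
  rewrite setU_symdiff //; have [->|U0] := eqVneq U set0; first by rewrite set0U.
  exact: (card_union_bound triv Cj).
have wtog U : P U -> weight C (symdiff U X) = (- weight C U)%R.
  case/andP=> UL UC; have [XU|dis] := Xcomp _ UC.
    have dis : [disjoint U :\: X & X].
      by rewrite -setI_eq0 setIDAC setDIl setDv setI0 eqxx.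
    rewrite setD_symdiff // -[U in RHS](setID U X) setUC (setIidPr XU).
    by rewrite weightU // wX mulrN1 opprK.
  by rewrite setU_symdiff // weightU // wX mulrN1.
have sum0 : (\sum_(U : {set 'I_n} | P U) weight C U = 0)%R.
  set s := (\sum_(_ | _) _)%R.
  have : s = (- s)%R.
    rewrite {1}/s (reindex_inj (inv_inj (symdiffK X))) /= -sumrN.
    rewrite (eq_bigl P) => [|U]; first exact: eq_bigr.
    by apply/idP/idP => [/Ptog|/Ptog //]; rewrite symdiffK.
  by clear; lia.
rewrite (bigD1 set0) in sum0; last first.
  by rewrite /P cards0 boundary0 sub0set.
have w0 : weight C set0 = 1%R.
  have -> : weight C set0 = ((-1) ^+ 0)%R; last by [].
  rewrite /weight cards0 (_ : inner G set0 = set0) ?set0D ?cards0 //.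
  by apply/setP => e; rewrite in_inner !in_set0.
rewrite w0 in sum0; apply/eqP; rewrite -addr_eq0 addrC; apply/eqP.
rewrite -[RHS]sum0; congr (_ + _)%R; apply: eq_bigl => U.
by rewrite /P card_gt0 -andbA andbC.
Qed.

(** If [C] is a non-trivial minimal cut set, any [U] in the sum would have boundary [C] and order
    below the girth, making [C] trivial. If [C] is no cut set, the sum is empty. Otherwise every
    minimal cut set inside [C] is trivial: proper subsets by their size, [C] itself by
    assumption. *)
Lemma local_identity C j L :
  (forall C', minimal_cut_set G C' -> #|C'| < j -> trivial_cut_set G C') ->
  #|C| = j -> j + n <= m + 1 ->
  (forall w, (w <= L) = (w * (k - 2) + 2 <= j)) ->
  2 * L < n -> L < girth G ->
  ((cut_set G C)%:R +
   \sum_(U : {set 'I_n} | (0 < #|U| <= L)%N && (boundary G U \subset C)) weight C U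
   = (nontrivial_cut_set G C)%:R)%R.
Proof.
move=> triv Cj jm Lj Ln Lg.
have proper_U U : 0 < #|U| <= L -> U != set0 /\ U != setT.
  case/andP; rewrite card_gt0 => U0 UL; split=> //.
  by apply: contraTneq UL => ->; rewrite cardsT card_ord; move: Ln; clear; lia.
have cut_U U : 0 < #|U| <= L -> boundary G U \subset C -> cut_set G (boundary G U).
  by move=> /proper_U[U0 UT] UC; apply/cut_setP => //; exists U.
have [nt|tr] := boolP (nontrivial_cut_set G C).
  have /andP[minC ntr] := nt; have /minsetP[cutC minC'] := minC.
  rewrite cutC big1 ?addr0 // => U /andP[UL UC]; case/negP: ntr.
  apply/(trivial_cutP n_gt0 conn minC); exists U; split.
  - by have [] := proper_U _ UL.
  - by apply: leq_ltn_trans Lg; case/andP: UL.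
  - by apply: minC' => //; apply: cut_U.
have [cutC|ncut] := boolP (cut_set G C); last first.
  rewrite big1 ?addr0 // => U /andP[UL UC]; case/negP: ncut.
  have [U0 UT] := proper_U _ UL.
  by apply/cut_setP => //; exists U.
rewrite (sum_weight_cut (j := j)) ?Cj // => C' minC' C'C.
have [E|CC'] := eqVneq C' C.
  by move: tr; rewrite /nontrivial_cut_set -E minC' /= negbK.
apply: triv => //; rewrite -Cj; apply: proper_card.
by rewrite properEneq CC'.
Qed.

End LocalIdentity.

(** * Reduction to counting induced subgraphs *)

Local Open Scope ring_scope.

(* The generating polynomial of the left-hand side over j is the product over T
   of the factors X on A, X - 1 on B and X + 1 elsewhere. *)
Lemma sum_signed_supersets (T : finType) (A B : {set T}) (j : nat) :
  [disjoint A & B] ->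
  \sum_(C : {set T} | (#|C| == j) && (A \subset C)) (-1) ^+ #|B :\: C| =
  ('X^#|A| * ('X - 1) ^+ #|B| * ('X + 1) ^+ (#|T| - #|A| - #|B|))`_j :> int.
Proof.
move=> dis.
(* [g e] is the constant term of the factor at [e]. Expanding the product chooses ['X] on [C] and
   [g] elsewhere, and the value 0 on [A] kills every [C] that does not contain [A]. *)
pose g (e : T) : {poly int} := if e \in A then 0 else if e \in B then - 1 else 1.
have -> : 'X^#|A| * ('X - 1) ^+ #|B| * ('X + 1) ^+ (#|T| - #|A| - #|B|) =
          \prod_e ('X + g e) :> {poly int}.
  rewrite (bigID (mem A)) /= [X in _ = _ * X](bigID (mem B)) /= mulrA.
  congr (_ * _ * _).
  - rewrite (eq_bigr (fun=> 'X)) => [|e eA]; first by rewrite prodr_const.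
    by rewrite /g eA addr0.
  - rewrite (eq_bigl (mem B)) => [|e]; last first.
      by rewrite /= andbC; case: (boolP (e \in B)) => // /(disjointFl dis) ->.
    rewrite (eq_bigr (fun=> 'X - 1)) => [|e eB]; first by rewrite prodr_const.
    by rewrite /g (disjointFl dis eB) (eB : e \in B).
  - rewrite (eq_bigl (mem (~: (A :|: B)))) => [|e]; last first.
      by rewrite /= !inE negb_or.
    rewrite (eq_bigr (fun=> 'X + 1)) => [|e]; last first.
      by rewrite !inE negb_or /g => /andP[/negbTE -> /negbTE ->].
    rewrite prodr_const; congr (_ ^+ _).
    rewrite -subnDA -(cardsC (A :|: B)) cardsU.
    by rewrite (_ : A :&: B = set0) ?cards0 ?subn0 ?addKn //; apply/eqP;
      rewrite setI_eq0.
rewrite bigA_distr coef_sum big_mkcond; apply: eq_bigr => C _.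
have [AC|/subsetPn[e eA eC]] := boolP (A \subset C); last first.
  by rewrite andbF (bigD1 e) //= (negbTE eC) /g eA mul0r coef0.
have -> : \prod_e (if e \in C then 'X else g e) = 'X^#|C| * ((-1) ^+ #|B :\: C|)%:P.
  rewrite (bigID (mem C)) /=; congr (_ * _).
    rewrite (eq_bigr (fun=> 'X)) => [|e ->] //; by rewrite prodr_const.
  rewrite (bigID (mem B)) /= [X in _ * X]big1 ?mulr1 => [|e]; last first.
    case/andP=> eC eB; rewrite (negbTE eC) /g (negbTE eB).
    by rewrite (contraNF (subsetP AC e) eC).
  rewrite (eq_bigl (mem (B :\: C))) => [|e]; last by rewrite /= !inE.
  rewrite (eq_bigr (fun=> - 1)) => [|e]; last first.
    rewrite !inE => /andP[eC eB]; rewrite (negbTE eC) /g eB.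
    by rewrite (contraNF (subsetP AC e) eC).
  by rewrite prodr_const rmorphXn rmorphN rmorph1.
by rewrite andbT coefMC coefXn eq_sym; case: eqP; rewrite ?mul1r ?mul0r.
Qed.

Lemma eq_sum_of_fibers (T I : finType) (V : nmodType) (P Q : pred T)
    (f g : T -> I) (phi : I -> V) :
  (forall i, #|[set x | P x & f x == i]| = #|[set x | Q x & g x == i]|) ->
  \sum_(x | P x) phi (f x) = \sum_(x | Q x) phi (g x).
Proof.
move=> fib; rewrite (partition_big f predT) // [RHS](partition_big g predT) //=.
apply: eq_bigr => i _.
rewrite (eq_bigr (fun=> phi i)) => [|x /andP[_ /eqP ->] //].
rewrite [RHS](eq_bigr (fun=> phi i)) => [|x /andP[_ /eqP ->] //].
rewrite !sumr_const; congr (_ *+ _).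
by rewrite -[LHS]cardsE -[RHS]cardsE; apply: fib.
Qed.

Section WeightSum.
Variables (n m k : nat) (G : mgraph n m).

(** After exchanging the sums, [sum_signed_supersets] applies to the boundary and the inner edges of
    each [U]. Regularity gives the size of the boundary, so each term depends only on the order of
    [U] and its number of inner edges. *)
Lemma sum_weight j (P : pred nat) : regular k G ->
  \sum_(C : {set 'I_m} | #|C| == j)
    \sum_(U : {set 'I_n} | P #|U| && (boundary G U \subset C)) weight G C U =
  \sum_(U : {set 'I_n} | P #|U|) (-1) ^+ #|U| *
    ('X^(k * #|U| - 2 * #|inner G U|) * ('X - 1) ^+ #|inner G U| *
     ('X + 1) ^+ (m - (k * #|U| - 2 * #|inner G U|) - #|inner G U|))`_j.
Proof.
move=> reg; rewrite (exchange_big_dep (fun U : {set 'I_n} => P #|U|)) /=; last first.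
  by move=> C U _ /andP[].
apply: eq_bigr => U PU.
have <- : #|boundary G U| = (k * #|U| - 2 * #|inner G U|)%N.
  by rewrite (regular_boundary U reg) addKn.
have := sum_signed_supersets j (boundary_inner_disjoint G (subxx U)).
rewrite card_ord => <-.
rewrite big_distrr /=; apply: eq_big => [C|C _]; first by rewrite PU.
by rewrite /weight exprD.
Qed.
End WeightSum.

Lemma sum_weight_eq n m k (G H : mgraph n m) j L :
  regular k G -> regular k H ->
  (forall w i, (0 < w <= L)%N ->
    #|[set U : {set 'I_n} | (#|U| == w) && (#|inner G U| == i)]| =
    #|[set U : {set 'I_n} | (#|U| == w) && (#|inner H U| == i)]|) ->
  \sum_(C : {set 'I_m} | #|C| == j)
    \sum_(U : {set 'I_n} | (0 < #|U| <= L)%N && (boundary G U \subset C)) weight G C U =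
  \sum_(C : {set 'I_m} | #|C| == j)
    \sum_(U : {set 'I_n} | (0 < #|U| <= L)%N && (boundary H U \subset C)) weight H C U.
Proof.
move=> regG regH cnt.
rewrite (sum_weight j (fun w => 0 < w <= L)%N regG).
rewrite (sum_weight j (fun w => 0 < w <= L)%N regH).
(* Both cardinalities are in range, so [inord] loses nothing. *)
pose ty (K : mgraph n m) (U : {set 'I_n}) : 'I_n.+1 * 'I_m.+1 :=
  (inord #|U|, inord #|inner K U|).
have cU (U : {set 'I_n}) : (#|U| < n.+1)%N.
  by rewrite ltnS -[X in (_ <= X)%N](card_ord n) max_card.
have cE (F : {set 'I_m}) : (#|F| < m.+1)%N.
  by rewrite ltnS -[X in (_ <= X)%N](card_ord m) max_card.
pose phi (p : 'I_n.+1 * 'I_m.+1) : int := (-1) ^+ p.1 *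
  ('X^(k * p.1 - 2 * p.2) * ('X - 1) ^+ p.2 * ('X + 1) ^+ (m - (k * p.1 - 2 * p.2) - p.2))`_j.
rewrite (eq_bigr (fun U => phi (ty G U))) => [|U _]; last by rewrite /phi !inordK.
rewrite [RHS](eq_bigr (fun U => phi (ty H U))) => [|U _]; last by rewrite /phi !inordK.
apply: eq_sum_of_fibers => -[w i].
have tyE K (U : {set 'I_n}) : (ty K U == (w, i)) = (#|U| == w) && (#|inner K U| == i).
  by rewrite xpair_eqE -!val_eqE /= !inordK.
have [wL|wL] := boolP (0 < w <= L)%N.
  have E (K : mgraph n m) : [set U : {set 'I_n} | (0 < #|U| <= L)%N & ty K U == (w, i)] =
             [set U : {set 'I_n} | (#|U| == w) && (#|inner K U| == i)].
    apply/setP => U; rewrite !inE tyE; case: eqP => [->|_]; rewrite ?andbF //.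
    by rewrite wL.
  by rewrite !E cnt.
have E (K : mgraph n m) : [set U : {set 'I_n} | (0 < #|U| <= L)%N & ty K U == (w, i)] = set0.
  apply/setP => U; rewrite !inE tyE; case: eqP => [->|_]; rewrite ?andbF //.
  by rewrite (negbTE wL).
by rewrite !E.
Qed.

Local Close Scope ring_scope.

(** * Counting injective homomorphisms *)

Section Update.
Variables (I V : finType).
Implicit Types (f : {ffun I -> V}) (T : {set I}) (R : {set I * I}).

Definition update f x z : {ffun I -> V} := [ffun a => if a == x then z else f a].

Lemma update_id f x z : update f x z x = z.
Proof. by rewrite ffunE eqxx. Qed.

Lemma update_neq f x z a : a != x -> update f x z a = f a.
Proof. by rewrite ffunE => /negbTE ->. Qed.

(** Swapping [z] with the old value at [x] is an involution on the pairs [(f, z)]. *)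
Lemma sum_update x (F : {ffun I -> V} -> nat) :
  \sum_f \sum_z F (update f x z) = #|V| * \sum_f F f.
Proof.
rewrite pair_bigA /=; pose h (p : {ffun I -> V} * V) := (update p.1 x p.2, p.1 x).
have hK : involutive h.
  case=> f z; congr (_, _); last exact: update_id.
  apply/ffunP => a; rewrite !ffunE /=.
  by case: eqP => [->|].
rewrite (reindex_inj (inv_inj hK)) (eq_bigr (fun p => F p.1)) => [|p _]; last first.
  by rewrite -[update _ _ _]/((h (h p)).1) hK.
rewrite -(pair_bigA _ (fun f _ => F f)) /= big_distrr /=.
by apply: eq_bigr => f _; rewrite sum_nat_const.
Qed.

Lemma imset_update f T x z : x \in T ->
  (#|update f x z @: T| == #|T|) =
  (#|f @: (T :\ x)| == #|T :\ x|) && (z \notin f @: (T :\ x)).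
Proof.
move=> xT.
have -> : update f x z @: T = z |: f @: (T :\ x).
  rewrite -{1}(setD1K xT) imsetU1 update_id; congr (_ |: _).
  apply: eq_in_imset => a; rewrite in_setD1 => /andP[ax _].
  exact: update_neq.
rewrite cardsU1 (cardsD1 x T) xT; case: (z \notin _) => /=.
  by rewrite eqn_add2l andbT.
rewrite andbF; apply/negbTE; rewrite neq_ltn add0n add1n ltnS.
by rewrite leq_imset_card.
Qed.

End Update.

Section InjectiveHoms.
Variables (I V : finType) (r : rel V) (k L : nat).
Hypotheses (rsym : symmetric r) (rirr : irreflexive r).
Hypothesis rreg : forall y, #|[set z | r z y]| = k.
Hypothesis rdeg : forall W : {set V}, W != set0 -> #|W| <= L ->
  exists2 x, x \in W & #|[set y in W | r x y]| <= 1.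
Implicit Types (f : {ffun I -> V}) (T : {set I}) (R : {set I * I}).

(** Injectivity on [T] is expressed by the size of the image. [R] may list an edge in either
    direction, or in both, as [r] is symmetric. *)
Definition injhom T R f :=
  (#|f @: T| == #|T|) && [forall p in R, r (f p.1) (f p.2)].

Definition num_injhom T R := \sum_f injhom T R f.

(* The values of f outside T are unconstrained, which is why [#|V|] appears here
   and in [injhom_leaf]. *)
Lemma injhom_isolated T R x : x \in T ->
  (forall p, p \in R -> (p.1 != x) && (p.2 != x)) ->
  #|V| * num_injhom T R = (#|V| - #|T :\ x|) * num_injhom (T :\ x) R.
Proof.
move=> xT Rx; rewrite -(sum_update x) big_distrr /=; apply: eq_bigr => f _.
have E z : injhom T R (update f x z) = injhom (T :\ x) R f && (z \notin f @: (T :\ x)).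
  rewrite /injhom imset_update // -!andbA; congr (_ && _); rewrite andbC.
  congr (_ && _); apply: eq_forallb_in => p /Rx/andP[p1 p2].
  by rewrite !update_neq.
under eq_bigr do rewrite E.
have [inj|] := boolP (injhom (T :\ x) R f); last by rewrite big1 ?muln0.
rewrite muln1 -big_mkcond sum1_card -(cardsC (f @: (T :\ x))).
case/andP: (inj) => /eqP -> _; rewrite addKn.
by apply: eq_card => z; rewrite !inE.
Qed.

(* The k neighbours of f y split into admissible images of the leaf x and
   vertices f u already in use; in the latter case u y becomes a new edge. *)
Lemma injhom_leaf T R x y : x \in T -> y \in T -> y != x ->
  (forall p, p \in R -> [|| p == (x, y), p == (y, x) | (p.1 != x) && (p.2 != x)]) ->
  ((x, y) \in R) || ((y, x) \in R) ->
  let R' := [set p in R | (p.1 != x) && (p.2 != x)] in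
  #|V| * num_injhom T R + \sum_(u in T :\ x) num_injhom (T :\ x) ((u, y) |: R') =
  k * num_injhom (T :\ x) R'.
Proof.
move=> xT yT yx Rx xyR R'; rewrite -(sum_update x) /num_injhom [X in _ + X]exchange_big -big_split big_distrr /=.
apply: eq_bigr => f _.
have E z : injhom T R (update f x z) =
    [&& injhom (T :\ x) R' f, z \notin f @: (T :\ x) & r z (f y)].
  rewrite /injhom imset_update // -!andbA; congr (_ && _); rewrite andbCA.
  congr (_ && _); apply/forall_inP/andP => [H|[/forall_inP H rz] p pR].
    split; last first.
      case/orP: xyR => /H; rewrite /= update_id update_neq //.
      by rewrite rsym.
    apply/forall_inP => p; rewrite inE => /and3P[pR p1 p2].
    by have := H p pR; rewrite !update_neq.
  case/or3P: (Rx p pR) => [/eqP ->|/eqP ->|/andP[p1 p2]] /=.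
  - by rewrite update_id update_neq.
  - by rewrite update_id update_neq // rsym.
  - by rewrite !update_neq // H // inE pR p1.
have E2 u : injhom (T :\ x) ((u, y) |: R') f = injhom (T :\ x) R' f && r (f u) (f y).
  rewrite /injhom -andbA; congr (_ && _);
    apply/forall_inP/andP => [H|[/forall_inP H ru] p].
    split; last by apply: (H (u, y)); rewrite setU11.
    by apply/forall_inP => p pR; apply: H; rewrite in_setU1 pR orbT.
  by rewrite in_setU1 => /orP[/eqP -> //|]; apply: H.
under eq_bigr do rewrite E; under [X in _ + X]eq_bigr do rewrite E2.
have [inj|] := boolP (injhom (T :\ x) R' f); last first.
  by rewrite !big1 ?muln0.
rewrite /= muln1 -(rreg (f y)) -!big_mkcond -!big_mkcondr /= !sum1_card.
case/andP: (inj) => /imset_injP finj _.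
rewrite -(cardsID (f @: (T :\ x)) [set z | r z (f y)]) addnC; congr (_ + _).
  have -> : [set z | r z (f y)] :&: f @: (T :\ x) = f @: [set u in T :\ x | r (f u) (f y)].
    apply/setP => z; rewrite inE; apply/andP/imsetP => [[]|[u]].
      rewrite inE => rz /imsetP[u uT zE]; exists u => //.
      by rewrite inE uT -zE.
    rewrite inE => /andP[uT ru] ->; rewrite inE ru; split=> //.
    exact: imset_f.
  rewrite card_in_imset => [|a b]; last first.
    by move=> /setIdP[aT _] /setIdP[bT _]; apply: finj.
  by apply: eq_card => u; rewrite [in RHS]in_set.
by apply: eq_card => z; rewrite [in RHS]in_setD [in RHS]in_set.
Qed.

Lemma injhom_loop T R a : (a, a) \in R -> num_injhom T R = 0.
Proof.
move=> aR; apply: big1 => f _; rewrite /injhom.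
suff -> : [forall p in R, r (f p.1) (f p.2)] = false by rewrite andbF.
by apply/negbTE/forall_inPn; exists (a, a); rewrite ?rirr.
Qed.

(** The image of [T] would be a set of at most [L] vertices, each with two neighbours in it, against
    [rdeg]. *)
Lemma injhom_dense T R : T != set0 -> #|T| <= L ->
  (forall x, x \in T -> exists y z, [/\ y \in T, z \in T, y != z,
     ((x, y) \in R) || ((y, x) \in R) & ((x, z) \in R) || ((z, x) \in R)]) ->
  num_injhom T R = 0.
Proof.
move=> T0 TL dense; apply: big1 => f _.
have [/andP[fT /forall_inP Rf]|] // := boolP (injhom T R f).
have [||_ /imsetP[x xT ->]] := rdeg (W := f @: T).
- by have [x xT] := set0Pn _ T0; apply/set0Pn; exists (f x); rewrite imset_f.
- by rewrite (eqP fT).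
have [y [z [yT zT yz Ry Rz]]] := dense x xT.
have radj a : ((x, a) \in R) || ((a, x) \in R) -> r (f x) (f a).
  by case/orP => /Rf //=; rewrite rsym.
rewrite leqNgt => /negP[]; rewrite (cardD1 (f y)) (cardD1 (f z)) !inE !imset_f // !radj //=.
by rewrite (inj_in_eq (imset_injP fT)) // eq_sym yz.
Qed.

End InjectiveHoms.

(** Induction on [#|T|]. Patterns with a loop or with all degrees at least 2 have no injective
    homomorphism. Otherwise a vertex of degree at most 1 is removed by a recursion whose
    coefficients depend only on [#|V|], [#|T|] and [k]. The edges it adds may create loops or
    cycles, so [R] ranges over all patterns on [T]. *)
Lemma num_injhom_eq (I V : finType) (r s : rel V) (k L : nat) :
  symmetric r -> irreflexive r -> (forall y, #|[set z | r z y]| = k) ->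
  (forall W : {set V}, W != set0 -> #|W| <= L ->
    exists2 x, x \in W & #|[set y in W | r x y]| <= 1) ->
  symmetric s -> irreflexive s -> (forall y, #|[set z | s z y]| = k) ->
  (forall W : {set V}, W != set0 -> #|W| <= L ->
    exists2 x, x \in W & #|[set y in W | s x y]| <= 1) ->
  0 < #|V| ->
  forall (T : {set I}) (R : {set I * I}), R \subset setX T T -> #|T| <= L ->
  num_injhom r T R = num_injhom s T R.
Proof.
move=> rs ri rr rd ss si sr sd V0 T.
have [t] := ubnP #|T|; elim: t T => // t IH T Tt R RT TL.
have [T0|T0] := eqVneq T set0.
  have R0 : R = set0.
    apply/eqP; rewrite -subset0; apply: subset_trans RT _.
    by apply/subsetP => p; rewrite T0 !inE.
  apply: eq_bigr => f _; rewrite /injhom R0; congr (nat_of_bool (_ && _)).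
  by apply: eq_forallb_in => p; rewrite inE.
have [/existsP[a aR]|noloop] := boolP [exists a, (a, a) \in R].
  by rewrite (injhom_loop ri T aR) (injhom_loop si T aR).
pose nb x y := ((x, y) \in R) || ((y, x) \in R).
have [/forall_inP dense|] := boolP [forall x in T, exists y, exists z,
    [&& y \in T, z \in T, y != z, nb x y & nb x z]].
  have H x : x \in T -> exists y z, [/\ y \in T, z \in T, y != z, nb x y & nb x z].
    move=> /dense/existsP[y /existsP[z /and5P[? ? ? ? ?]]].
    by exists y, z; split.
  by rewrite (injhom_dense rs rd T0 TL H) (injhom_dense ss sd T0 TL H).
case/forall_inPn => x xT; rewrite negb_exists => /forallP sparse_x.
have TxT : #|T :\ x| < #|T| by rewrite (cardsD1 x T) xT.
have inT p : p \in R -> (p.1 \in T) && (p.2 \in T).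
  by move=> /(subsetP RT); rewrite inE.
have IHx (R' : {set I * I}) : R' \subset setX (T :\ x) (T :\ x) ->
    num_injhom r (T :\ x) R' = num_injhom s (T :\ x) R'.
  by move=> R'T; apply: IH => //;
    [apply: leq_trans TxT _ | apply: leq_trans (ltnW TxT) TL].
have [/existsP[y xy]|none] := boolP [exists y, nb x y]; last first.
  have Rx p : p \in R -> (p.1 != x) && (p.2 != x).
    move=> pR; rewrite -negb_or; apply: contra none => /orP[]/eqP E; apply/existsP.
      by exists p.2; rewrite /nb -E -surjective_pairing pR.
    by exists p.1; rewrite /nb -E -surjective_pairing pR orbT.
  apply/eqP; rewrite -(eqn_pmul2l V0) (injhom_isolated _ xT Rx) (injhom_isolated _ xT Rx).
  rewrite IHx //; apply/subsetP => p pR; rewrite !inE.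
  by have /andP[-> ->] := Rx p pR; have /andP[-> ->] := inT p pR.
have yT : y \in T by case/orP: xy => /inT/andP[].
have yx : y != x.
  apply: contra noloop => /eqP E; apply/existsP; exists x.
  by move: xy; rewrite /nb E orbb.
have uniq_y z : nb x z -> z = y.
  move=> xz; apply/eqP; apply: contraT => zy.
  have zT : z \in T by case/orP: xz => /inT/andP[].
  have := sparse_x z; rewrite negb_exists => /forallP/(_ y).
  by rewrite zT yT zy xz xy.
have Rx p : p \in R -> [|| p == (x, y), p == (y, x) | (p.1 != x) && (p.2 != x)].
  case: p => a b abR; rewrite !xpair_eqE /=.
  have [ax|ax] := eqVneq a x.
    by rewrite (uniq_y b) ?eqxx // /nb -ax abR.
  have [bx|_] := eqVneq b x; last by rewrite orbT.
  by rewrite (uniq_y a) ?eqxx ?orbT // /nb -bx abR orbT.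
have R'T : [set p in R | (p.1 != x) && (p.2 != x)] \subset setX (T :\ x) (T :\ x).
  apply/subsetP => p; rewrite !inE => /and3P[/inT/andP[p1 p2] -> ->].
  by rewrite p1 p2.
have Er := injhom_leaf rs rr xT yT yx Rx xy.
have Es := injhom_leaf ss sr xT yT yx Rx xy.
rewrite /= in Er Es; apply/eqP; rewrite -(eqn_pmul2l V0); apply/eqP.
rewrite -(IHx _ R'T) -Er in Es.
have Eu : \sum_(u in T :\ x) num_injhom r (T :\ x)
            ((u, y) |: [set p in R | (p.1 != x) && (p.2 != x)]) =
          \sum_(u in T :\ x) num_injhom s (T :\ x)
            ((u, y) |: [set p in R | (p.1 != x) && (p.2 != x)]).
  apply: eq_bigr => u uT; apply: IHx; rewrite subUset R'T andbT sub1set.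
  by rewrite in_setX uT in_setD1 yx.
by move/eqP: Es; rewrite Eu eqn_add2r => /eqP ->.
Qed.

(** * From injective homomorphisms to induced subgraphs *)

Section InjCount.
Variables (I V : finType).

(** Expanding each power of X as a power of (X - 1) + 1 is inclusion-exclusion: it relates exact
    numbers of adjacent pairs to homomorphism counts of all patterns [R]. *)
Lemma sum_poly_injhom (r : rel V) :
  (\sum_(f : {ffun I -> V} | #|f @: [set: I]| == #|[set: I]|)
      'X^#|[set p : I * I | r (f p.1) (f p.2)]| =
   \sum_(R : {set I * I}) ('X - 1) ^+ #|R| *+ num_injhom r setT R :> {poly int})%R.
Proof.
under [RHS]eq_bigr do rewrite -sumrMnr.
rewrite [RHS]exchange_big big_mkcond /=; apply: eq_bigr => f _.
rewrite /injhom; case: ifP => _ /=; last by rewrite big1.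
set A := [set p | _].
have -> : ('X^#|A| = \prod_p ((if p \in A then 'X - 1 else 0) + 1) :> {poly int})%R.
  rewrite -prodr_const big_mkcond; apply: eq_bigr => p _.
  by case: ifP; rewrite ?subrK ?add0r.
rewrite bigA_distr; apply: eq_bigr => R _.
have [RA|] := boolP [forall p in R, r (f p.1) (f p.2)].
  rewrite mulr1n -prodr_const [RHS]big_mkcond; apply: eq_bigr => p _.
  by case: ifP => // pR; rewrite inE (forall_inP RA).
by case/forall_inPn => p pR np; rewrite (bigD1 p) //= pR inE (negbTE np) mul0r.
Qed.

Lemma card_injhom_eq (r s : rel V) i :
  (forall R : {set I * I}, num_injhom r setT R = num_injhom s setT R) ->
  #|[set f : {ffun I -> V} | (#|f @: [set: I]| == #|[set: I]|) &&
     (#|[set p : I * I | r (f p.1) (f p.2)]| == i)]| =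
  #|[set f : {ffun I -> V} | (#|f @: [set: I]| == #|[set: I]|) &&
     (#|[set p : I * I | s (f p.1) (f p.2)]| == i)]|.
Proof.
move=> E; have := sum_poly_injhom r.
under [X in _ = X -> _]eq_bigr do rewrite E.
rewrite -sum_poly_injhom => /(congr1 (fun p : {poly int} => p`_i)%R).
have count (t : rel V) : ((\sum_(f : {ffun I -> V} | #|f @: [set: I]| == #|[set: I]|)
      'X^#|[set p : I * I | t (f p.1) (f p.2)]| : {poly int})`_i)%R =
   (#|[set f : {ffun I -> V} | (#|f @: [set: I]| == #|[set: I]|) &&
     (#|[set p : I * I | t (f p.1) (f p.2)]| == i)]|%:R)%R.
  rewrite coef_sum -[X in (_ = X%:R)%R]sum1_card natr_sum big_mkcond [RHS]big_mkcond /=.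
  apply: eq_bigr => f _; rewrite inE; case: (_ == #|_|) => //=.
  by rewrite coefXn eq_sym; case: eqP.
by rewrite !count => /eqP; rewrite Num.Theory.eqr_nat => /eqP.
Qed.

Lemma card_inj_by_image (Q : pred {set V}) :
  #|[set f : {ffun I -> V} | (#|f @: [set: I]| == #|[set: I]|) && Q (f @: [set: I])]| =
  #|I|`! * #|[set U : {set V} | (#|U| == #|I|) && Q U]|.
Proof.
rewrite -sum1_card (partition_big (fun f : {ffun I -> V} => f @: [set: I])
  (mem [set U : {set V} | (#|U| == #|I|) && Q U])) /=; last first.
  by move=> f; rewrite !inE cardsT.
rewrite mulnC -sum_nat_const; apply: eq_bigr => U; rewrite inE => /andP[/eqP cU QU].
rewrite sum1_card -[RHS]ffactnn -[X in X ^_ _]cU -card_inj_ffuns_on.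
apply: eq_card => f; rewrite [RHS]inE.
transitivity ((f \in [set f : {ffun I -> V} | (#|f @: [set: I]| == #|[set: I]|)
  && Q (f @: [set: I])]) && (f @: [set: I] == U)); first by [].
rewrite inE cardsT.
apply/andP/andP => [[/andP[cf _] /eqP fU]|[/ffun_onP fU /injectiveP finj]].
  split; first by apply/ffun_onP => a; rewrite -fU imset_f.
  by apply/injectiveP => a b; apply: (imset_injP (D := setT)); rewrite ?cardsT.
have fE : f @: setT = U.
  apply/eqP; rewrite eqEcard cU card_imset // cardsT leqnn andbT.
  by apply/subsetP => _ /imsetP[a _ ->].
by rewrite fE cU eqxx QU eqxx.
Qed.

End InjCount.

(** * Regular graphs of girth greater than 2 *)

Section Simple.
Variables (n m k : nat) (G : mgraph n m).
Hypotheses (girth_gt2 : 2 < girth G) (reg : regular k G).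
Implicit Types (W : {set 'I_n}).

Lemma adj_sym (F : {set 'I_m}) : symmetric (adj G F).
Proof. by move=> x y; apply: eq_existsb => e; rewrite setUC. Qed.

Lemma no_loop e : src G e != tgt G e.
Proof.
apply/eqP => E.
have S0 : [set src G e] != set0 by apply/set0Pn; exists (src G e); rewrite inE.
have := girth_sparse (G := G) S0; rewrite cards1 => /(_ (ltnW girth_gt2)).
rewrite ltnS leqn0 cards_eq0 => /eqP/setP/(_ e).
by rewrite in_inner !inE -E eqxx.
Qed.

Lemma ends_inj : injective (ends G).
Proof.
move=> e e' E; apply/eqP; apply: contraT => ee'.
have e2 : #|ends G e| = 2 by rewrite endsE cards2 no_loop.
have e0 : ends G e != set0 by rewrite -card_gt0 e2.
have := girth_sparse (G := G) e0; rewrite e2 => /(_ girth_gt2);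
  rewrite ltnNge => /negP[].
have : [set e; e'] \subset inner G (ends G e).
  rewrite subUset !sub1set !in_inner {1 2}endsE E endsE.
  by rewrite !inE !eqxx ?orbT.
by move/subset_leq_card; rewrite cards2 ee'.
Qed.

Lemma adj_irr (F : {set 'I_m}) : irreflexive (adj G F).
Proof.
move=> x; apply/negbTE/existsPn => e; apply/negP => /andP[_ /eqP].
by have := no_loop e; move=> ne /ends_src_tgt[] [sE tE]; rewrite sE tE eqxx in ne.
Qed.

Lemma card_neighbors y : #|[set z | adj G setT z y]| = k.
Proof.
have /forallP/(_ y)/eqP <- := reg.
rewrite /degree [X in _ + X](_ : _ = 0) ?addn0; last first.
  apply/eqP; rewrite cards_eq0 -subset0; apply/subsetP => e;
    rewrite inE endsE => /eqP E.
  have := no_loop e; have := set21 (src G e) (tgt G e);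
    have := set22 (src G e) (tgt G e).
  by rewrite E !inE => /eqP -> /eqP ->; rewrite eqxx.
pose other e := if src G e == y then tgt G e else src G e.
have otherE e : y \in ends G e -> ends G e = [set other e; y].
  rewrite endsE !inE /other (eq_sym y); case: eqP => [-> _|_ /= /eqP -> //].
  by rewrite setUC.
have -> : [set z | adj G setT z y] = other @: [set e | y \in ends G e].
  apply/setP => z; rewrite inE; apply/existsP/imsetP => [[e /andP[_ /eqP E]]|[e]].
    have ye : y \in ends G e by rewrite E set22.
    exists e; first by rewrite inE.
    have := otherE e ye; rewrite E => /set2_eq[[-> _] //|[zy yo]].
    by rewrite zy -yo.
  by rewrite inE => /otherE E ->; exists e; rewrite inE E eqxx.
rewrite card_in_imset // => e e'; rewrite !inE => /otherE E /otherE E' oE.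
by apply: ends_inj; rewrite E E' oE.
Qed.

Lemma card_adjacent_pairs W :
  #|[set p | [&& p.1 \in W, p.2 \in W & adj G setT p.1 p.2]]| = 2 * #|inner G W|.
Proof.
pose st e := (src G e, tgt G e); pose ts e := (tgt G e, src G e).
have -> : [set p | [&& p.1 \in W, p.2 \in W & adj G setT p.1 p.2]] =
          (st @: inner G W) :|: (ts @: inner G W).
  apply/setP => -[x y]; rewrite in_set in_setU /=.
  apply/and3P/orP => [[xW yW /existsP[e /andP[_ /eqP /ends_src_tgt E]]]|].
    case: E => [] [sE tE]; [left|right]; apply/imsetP; exists e => //;
      by rewrite ?in_inner /st /ts sE tE ?xW ?yW.
  case=> /imsetP[e]; rewrite in_inner => /andP[sW tW] [-> ->]; split=> //;
    apply/existsP; exists e; rewrite inE endsE //=.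
  by rewrite setUC.
have stinj : injective st.
  by move=> e e' [s t]; apply: ends_inj; rewrite !endsE s t.
have tsinj : injective ts.
  by move=> e e' [t s]; apply: ends_inj; rewrite !endsE s t.
rewrite cardsU !card_imset // addnn -mul2n.
rewrite (_ : _ :&: _ = set0) ?cards0 ?subn0 //; apply/eqP; rewrite -subset0.
apply/subsetP => p; rewrite inE => /andP[/imsetP[e _ ->] /imsetP[e' _ [E1 E2]]].
have ee' : e = e' by apply: ends_inj; rewrite !endsE E1 E2 setUC.
by have := no_loop e; rewrite E1 ee' eqxx.
Qed.

(** If all degrees inside [W] were at least 2, counting adjacent pairs would give at least [#|W|]
    inner edges. *)
Lemma low_degree W : W != set0 -> #|W| < girth G ->
  exists2 x, x \in W & #|[set y in W | adj G setT x y]| <= 1.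
Proof.
move=> W0 Wg; apply/exists_inP; apply: contraT;
  rewrite negb_exists_in => /forall_inP deg.
have := girth_sparse (G := G) W0 Wg; rewrite ltnNge => /negP[].
rewrite -(leq_pmul2l (m := 2)) // -card_adjacent_pairs mulnC -sum_nat_const.
rewrite -[X in _ <= X]sum1_card.
rewrite (eq_bigl (fun p => (p.1 \in W) && ((p.2 \in W) && adj G setT p.1 p.2)));
  last first.
  by move=> p; rewrite inE.
rewrite -(pair_big_dep (mem W) (fun x y => (y \in W) && adj G setT x y) (fun _ _ => 1)) /=.
apply: leq_sum => x /deg; rewrite -ltnNge sum1_card => /leq_trans; apply.
by apply/eq_leq/eq_card => y; rewrite inE.
Qed.

End Simple.

Lemma card_induced_eq n m k (G H : mgraph n m) w i :
  0 < n -> regular k G -> regular k H -> 0 < w -> w < girth G -> w < girth H ->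
  #|[set U : {set 'I_n} | (#|U| == w) && (#|inner G U| == i)]| =
  #|[set U : {set 'I_n} | (#|U| == w) && (#|inner H U| == i)]|.
Proof.
move=> n0 regG regH w0 wG wH.
(* For w = 1 parallel edges may occur and the results on girth above 2 do not apply, but the absence
   of loops leaves no inner edge. *)
have [w1|w2] := leqP w 1.
  have {w0}w1 : w = 1 by apply/eqP; rewrite eqn_leq w1.
  apply: eq_card => U; rewrite !inE; case: eqP => //= cU.
  have U0 : U != set0 by rewrite -card_gt0 cU w1.
  have zero (K : mgraph n m) : w < girth K -> #|inner K U| = 0.
    move=> wK; have := girth_sparse (G := K) U0; rewrite cU => /(_ wK).
    by rewrite w1; case: #|_|.
  by rewrite !zero.
have gG : 2 < girth G by apply: leq_ltn_trans wG.
have gH : 2 < girth H by apply: leq_ltn_trans wH.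
have homE R : num_injhom (adj G setT) [set: 'I_w] R = num_injhom (adj H setT) setT R.
  apply: (@num_injhom_eq _ _ _ _ k w); rewrite ?card_ord ?cardsT ?card_ord //.
  - exact: adj_sym.
  - exact: adj_irr.
  - exact: card_neighbors.
  - by move=> W W0 Ww; apply: low_degree => //; apply: leq_ltn_trans wG.
  - exact: adj_sym.
  - exact: adj_irr.
  - exact: card_neighbors.
  - by move=> W W0 Ww; apply: low_degree => //; apply: leq_ltn_trans wH.
  - by apply/subsetP => p _; rewrite !inE.
have key (K : mgraph n m) : 2 < girth K ->
   w`! * #|[set U : {set 'I_n} | (#|U| == w) && (#|inner K U| == i)]| =
   #|[set f : {ffun 'I_w -> 'I_n} | (#|f @: [set: 'I_w]| == #|[set: 'I_w]|) &&
     (#|[set p : 'I_w * 'I_w | adj K setT (f p.1) (f p.2)]| == 2 * i)]|.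
  move=> gK; have := card_inj_by_image 'I_w (fun U : {set 'I_n} => #|inner K U| == i).
  rewrite card_ord => <-; apply: eq_card => f; rewrite !inE.
  case: (boolP (_ == _)) => //= /imset_injP finj.
  rewrite -(eqn_pmul2l (m := 2)) // -card_adjacent_pairs //.
  have -> : [set p | [&& p.1 \in f @: setT, p.2 \in f @: setT & adj K setT p.1 p.2]] =
            (fun p => (f p.1, f p.2)) @: [set p : 'I_w * 'I_w | adj K setT (f p.1) (f p.2)].
    apply/setP => -[x y]; rewrite inE /=; apply/and3P/imsetP => [[]|[[a b]]].
      move=> /imsetP[a _ ->] /imsetP[b _ ->] ab; exists (a, b) => //.
      by rewrite inE.
    by rewrite inE /= => ab [-> ->]; rewrite !imset_f ?inE.
  rewrite card_imset // => -[a b] [a' b'] [E1 E2].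
  by congr (_, _); apply: finj; rewrite ?in_setT.
apply/eqP; rewrite -(eqn_pmul2l (fact_gt0 w)) !key //; apply/eqP.
exact: card_injhom_eq.
Qed.

(** * Reliability classes *)

Section Classes.
Variables (n m k : nat).
Hypotheses (k_gt2 : 2 < k) (n_gt1 : 1 < n) (hm : 2 * m = k * n).
Implicit Types (G H : mgraph n m) (C : {set 'I_m}).

(** [calD] with an arbitrary bound [j], needed for the induction; at [j = g * (k - 2)] the two agree
    by conversion. *)
Definition trivial_upto j : {set mgraph n m} :=
  [set G | regular k G &
    ~~ [exists C, nontrivial_cut_set G C && (#|C| <= j)]].

Lemma trivial_uptoP j G : reflect
  (regular k G /\
   forall C, minimal_cut_set G C -> #|C| <= j -> trivial_cut_set G C)
  (G \in trivial_upto j).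
Proof.
rewrite inE; apply: (iffP andP) => -[reg H]; split=> //.
  move=> C minC Cj; apply: contraNT H => ntr; apply/existsP; exists C.
  by rewrite /nontrivial_cut_set minC ntr.
apply/existsP => -[C /andP[/andP[minC /negP ntr] Cj]].
by apply: ntr; apply: H.
Qed.

Lemma trivial_upto_sub i j : i <= j -> trivial_upto j \subset trivial_upto i.
Proof.
move=> ij; apply/subsetP => G /trivial_uptoP[reg H]; apply/trivial_uptoP; split=> //.
by move=> C minC Ci; apply: H => //; apply: leq_trans ij.
Qed.

Lemma trivial_cut_size G C : regular k G -> trivial_cut_set G C -> k <= #|C|.
Proof.
move=> reg /trivial_cut_tree[S [S0 Sg <-]].
have := sparse_boundary k_gt2 reg S0 (girth_sparse_set Sg).
by move: S0; rewrite -card_gt0; move: k_gt2; clear; nia.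
Qed.

Lemma no_small_cut j G C : G \in trivial_upto j -> cut_set G C -> #|C| <= j -> k <= #|C|.
Proof.
case/trivial_uptoP=> reg triv cutC Cj; have [C' minC' C'C] := minset_exists cutC.
have le := subset_leq_card C'C.
exact: leq_trans (trivial_cut_size reg (triv _ minC' (leq_trans le Cj))) le.
Qed.

Lemma trivial_upto_connected j G : G \in trivial_upto j -> ~~ cut_set G set0.
Proof.
move=> GD; apply/negP => /(no_small_cut GD); rewrite cards0 => /(_ isT).
by move: k_gt2; clear; case: k.
Qed.

Lemma m_gt0 : 0 < m.
Proof. by move: hm k_gt2 n_gt1; clear; nia. Qed.

Lemma cut_set_sub G C C' : C \subset C' -> cut_set G C -> cut_set G C'.
Proof.
have n0 := ltnW n_gt1; move=> CC' /(cut_setP _ _ n0)[S [S0 ST SC]].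
by apply/(cut_setP _ _ n0); exists S; rewrite (subset_trans SC).
Qed.

(** Trivial cut sets have at least [k] edges. Conversely, without smaller cut sets the boundary of
    each single vertex forces its degree to be at least [k], and the degree sum [k * n] forces
    equality. *)
Lemma trivial_upto_base G :
  reflect (forall i, 0 < i < k -> num_cut_sets i G = 0) (G \in trivial_upto k.-1).
Proof.
apply: (iffP idP) => [GD i /andP[i0 ik]|b0].
  apply/eqP; rewrite cards_eq0 -subset0; apply/subsetP => C.
  rewrite inE => /andP[cutC /eqP Ci].
  have ik1 : i <= k.-1 by rewrite -ltnS prednK // (ltn_trans _ k_gt2).
  by have := no_small_cut GD cutC; rewrite Ci => /(_ ik1); rewrite leqNgt ik.
have large C : cut_set G C -> k <= #|C|.
  move=> cutC; rewrite leqNgt; apply/negP => Ck.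
  have [C0|C0] := posnP #|C|; last first.
    have /eqP := b0 #|C| (introT andP (conj C0 Ck)).
    by rewrite cards_eq0 => /eqP/setP/(_ C); rewrite !inE cutC eqxx.
  (* If the empty set were a cut set, so would be any single edge, against the case i = 1. *)
  have /eqP := b0 1 (ltn_trans (isT : 1 < 2) k_gt2).
  rewrite cards_eq0 => /eqP/setP/(_ [set Ordinal m_gt0]);
    rewrite !inE cards1 eqxx andbT.
  move=> /negbT/negP[]; apply: cut_set_sub cutC.
  by rewrite (cards0_eq C0) sub0set.
apply/trivial_uptoP; split; last first.
  move=> C /minsetP[/large kC _] Ck; suff : false by [].
  by move: kC Ck k_gt2; clear; lia.
have deg x : k <= degree G x.
  have := sum_degree G [set x]; rewrite big_set1 => ->.
  apply: leq_trans (leq_addl _ _); apply: large.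
  apply/(cut_setP _ _ (ltnW n_gt1)); exists [set x]; split=> //.
    by apply/set0Pn; exists x; rewrite inE.
  apply/eqP => /(congr1 (fun A : {set 'I_n} => #|A|)); rewrite cards1 cardsT card_ord.
  by move: n_gt1; clear; lia.
have : \sum_x degree G x = 2 * m.
  have := sum_degree G setT.
  rewrite (eq_bigl xpredT) => [->|x]; last by rewrite inE.
  rewrite -(boundaryC G setT) setCT boundary0 cards0 addn0.
  have -> : inner G setT = setT by apply/setP => e; rewrite in_inner !inE.
  by rewrite cardsT card_ord.
rewrite (eq_bigr (fun x => k + (degree G x - k))) => [|x _]; last by rewrite subnKC.
rewrite big_split /= sum_nat_const card_ord hm mulnC => /eqP.
rewrite -[X in _ == X]addn0 eqn_add2l sum_nat_eq0 => /forallP H.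
apply/forallP => x; have := H x; rewrite /= subn_eq0 => le.
by rewrite eqn_leq le deg.
Qed.

Definition num_nontrivial j G := #|[set C | nontrivial_cut_set G C & #|C| == j]|.

Lemma trivial_uptoS j G : (G \in trivial_upto j.+1) =
  (G \in trivial_upto j) && (num_nontrivial j.+1 G == 0).
Proof.
rewrite cards_eq0; apply/idP/andP => [GD|[/trivial_uptoP[reg H] /eqP/setP none]].
  split; first exact: subsetP (trivial_upto_sub (leqnSn j)) _ GD.
  have /trivial_uptoP[_ H] := GD; rewrite -subset0; apply/subsetP => C.
  rewrite inE => /andP[/andP[minC /negP ntr] /eqP Cj]; case: ntr.
  by apply: H; rewrite ?Cj.
apply/trivial_uptoP; split=> // C minC; rewrite leq_eqVlt => /orP[Cj|]; last exact: H.
have := none C; rewrite !inE Cj andbT /nontrivial_cut_set minC /=.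
exact: negbFE.
Qed.

(** [local_identity] is summed over all edge sets of size [j.+1]; the signed sums for [G] and [H]
    agree by [sum_weight_eq] and [card_induced_eq]. *)
Lemma num_cut_sets_excess_small j G H :
  j.+1 + n <= m + 1 -> 1 < j.+1 ->
  G \in trivial_upto j -> H \in trivial_upto j ->
  num_cut_sets j.+1 G + num_nontrivial j.+1 H = num_cut_sets j.+1 H + num_nontrivial j.+1 G.
Proof.
move=> jm j2 GD HD; have n0 := ltnW n_gt1.
pose L := (j.+1 - 2) %/ (k - 2).
have k2 : 0 < k - 2 by rewrite subn_gt0.
have Lj w : (w <= L) = (w * (k - 2) + 2 <= j.+1).
  by rewrite leq_divRL // leq_subRL // addnC.
(* From L (k - 2) + 2 <= j + 1 <= m - n + 1, where 2 (m - n) = n (k - 2). *)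
have Ln : 2 * L < n.
  have := Lj L; rewrite leqnn => /esym; move: jm hm k_gt2; clearbody L; clear.
  by nia.
(* A girth at most [L] would satisfy the bound of [short_girth_small_order], giving n < 2L against
   [Ln]. *)
have Lg K : K \in trivial_upto j -> L < girth K.
  move=> KD; rewrite ltnNge; apply/negP => gL.
  have /trivial_uptoP[reg triv] := KD.
  have := short_girth_small_order n0 (trivial_upto_connected KD) k_gt2 reg triv.
  have gj : girth K * (k - 2) <= j.
    by have := Lj (girth K); rewrite gL; clear; lia.
  have gn : girth K <= n by move: gL Ln; clear; lia.
  by move=> /(_ gn gj); move: gL Ln; clear; lia.
have total K : K \in trivial_upto j ->
    ((num_cut_sets j.+1 K)%:R + \sum_(C : {set 'I_m} | #|C| == j.+1)
      \sum_(U : {set 'I_n} | (0 < #|U| <= L)%N && (boundary K U \subset C)) weight K C U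
     = (num_nontrivial j.+1 K)%:R :> int)%R.
  move=> KD; have /trivial_uptoP[reg triv] := KD.
  have cnt (P : pred {set 'I_m}) : (#|[set C | P C & #|C| == j.+1]|%:R =
      \sum_(C : {set 'I_m} | #|C| == j.+1) (P C)%:R :> int)%R.
    rewrite -sum1_card natr_sum big_mkcond [RHS]big_mkcond /=.
    by apply: eq_bigr => C _; rewrite inE; case: (P C); case: (_ == _).
  rewrite /num_cut_sets /num_nontrivial !cnt -big_split /=.
  apply: eq_bigr => C /eqP Cj.
  apply: (local_identity n0 (trivial_upto_connected KD) k_gt2 reg (j := j.+1)) => //.
  exact: Lg KD.
have /trivial_uptoP[regG _] := GD; have /trivial_uptoP[regH _] := HD.
have := total G GD; have := total H HD.
rewrite (@sum_weight_eq _ _ k G H j.+1 L regG regH).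
  move: (\sum_(C : {set 'I_m} | _) _)%R => s; clear; lia.
move=> w i /andP[w0 wL]; apply: (card_induced_eq _ n0 regG regH w0).
  exact: leq_ltn_trans wL (Lg _ GD).
exact: leq_ltn_trans wL (Lg _ HD).
Qed.

(** Fewer than n - 1 edges remain, too few to connect all vertices. *)
Lemma num_cut_sets_large j G : m + 1 < j + n -> num_cut_sets j G = 'C(m, j).
Proof.
move=> jm; have := cards_draws [set: 'I_m] j; rewrite cardsT card_ord => <-;
  apply: eq_card => C.
rewrite !inE subsetT; case: eqP => [Cj|]; rewrite ?andbF //= andbT.
have T0 : [set: 'I_n] != set0.
  by rewrite -card_gt0 cardsT card_ord ltnW.
have few : #|~: C :&: inner G setT| + 1 < #|[set: 'I_n]|.
  have := subset_leq_card (subsetIl (~: C) (inner G setT)).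
  by have := cardsC C; rewrite cardsT !card_ord Cj; move: jm; clear; lia.
have [Y [Y0 YT noY]] := split_few_edges T0 few.
apply/(cut_setP _ _ (ltnW n_gt1)); exists Y; split=> //.
  by rewrite proper_neq.
apply/subsetP => e; apply: contraLR => eC; apply: noY.
by rewrite in_setI in_setC eC in_inner !inE.
Qed.

(** Both sides of a non-trivial minimal cut set have at least h vertices, h being the girth, so 2h
    <= n. Then h (k - 2) <= m - n <= j, and [short_girth_small_order] gives n < 2h. *)
Lemma num_nontrivial_large j G : m + 1 < j.+1 + n -> G \in trivial_upto j ->
  num_nontrivial j.+1 G = 0.
Proof.
move=> jm GD; have n0 := ltnW n_gt1; have conn := trivial_upto_connected GD.
have /trivial_uptoP[reg triv] := GD.
apply/eqP; rewrite cards_eq0 -subset0; apply/subsetP => C; rewrite inE.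
move=> /andP[/andP[minC ntr] /eqP Cj].
have [S [S0 ST SC]] := minimal_cutP n0 minC.
have big_side X : X != set0 -> boundary G X = C -> girth G <= #|X|.
  move=> X0 XC; rewrite leqNgt; apply: contra ntr => Xg.
  by apply/(trivial_cutP n0 conn minC); exists X.
have gS := big_side S S0 SC.
have gS' : girth G <= #|~: S|.
  apply: big_side; last by rewrite boundaryC.
  by apply: contra ST => /eqP E; rewrite -(setCK S) E setC0.
have cS := cardsC S; rewrite card_ord in cS.
have := short_girth_small_order n0 conn k_gt2 reg triv.
have gn : girth G <= n by move: gS gS' cS; clear; lia.
have gj : girth G * (k - 2) <= j.
  by move: #|S| #|~: S| gS gS' cS jm hm k_gt2 => a b; clear; nia.
move=> /(_ gn gj); move: #|S| #|~: S| gS gS' cS => a b; clear; lia.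
Qed.

Lemma num_cut_sets_excess j G H : 1 < j.+1 ->
  G \in trivial_upto j -> H \in trivial_upto j.+1 ->
  num_cut_sets j.+1 G = num_cut_sets j.+1 H + num_nontrivial j.+1 G.
Proof.
move=> j2 GD; rewrite trivial_uptoS => /andP[HD /eqP H0].
have [le|lt] := leqP (j.+1 + n) (m + 1).
  by have := num_cut_sets_excess_small le j2 GD HD; rewrite H0 addn0.
by rewrite num_nontrivial_large // !num_cut_sets_large // addn0.
Qed.

(** [H] stays in every class and shows that each minimum is 0. *)
Lemma calA_base H j : H \in trivial_upto k.-1 -> j < k ->
  calA n m j = [set G | [forall i : 'I_k, (0 < i <= j) ==> (num_cut_sets i G == 0)]].
Proof.
move=> /trivial_upto_base H0; elim: j => [|j IH] jk.
  apply/setP => G; rewrite !inE; apply/esym/forallP => i.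
  by case: (val i).
apply/setP => G; rewrite /= inE IH ?(ltnW jk) //.
have HA : H \in [set G | [forall i : 'I_k, (0 < i <= j) ==> (num_cut_sets i G == 0)]].
  rewrite inE; apply/forallP => i; apply/implyP => /andP[i0 _].
  by rewrite H0 // i0 ltn_ord.
rewrite !inE; apply/andP/forallP => [[/forallP old /forall_inP min] i|all0].
  apply/implyP => /andP[i0]; rewrite leq_eqVlt => /orP[/eqP ij|ij].
    by have := min H HA; rewrite ij (H0 j.+1) ?leqn0 ?jk.
  by apply: (implyP (old i)); rewrite i0.
split.
  apply/forallP => i; apply/implyP => /andP[i0 ij].
  by apply: (implyP (all0 i)); rewrite i0 leqW.
apply/forall_inP => K _; have := all0 (Ordinal jk).
by rewrite /= ltnSn => /eqP ->.
Qed.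

(** A witness [H] for the bound [J] survives every step with excess 0, so the minimum is reached
    exactly by the graphs without non-trivial cut sets of the next size. *)
Lemma calA_trivial_upto J d : trivial_upto J != set0 -> k.-1 + d <= J ->
  calA n m (k.-1 + d) = trivial_upto (k.-1 + d).
Proof.
move=> /set0Pn[H HJ]; have k0 : 0 < k by apply: ltn_trans k_gt2.
elim: d => [|d IH] dJ.
  rewrite addn0 in dJ *; rewrite (@calA_base H) ?prednK //; last first.
    exact: subsetP (trivial_upto_sub dJ) _ HJ.
  apply/setP => G; rewrite inE; apply/forallP/trivial_upto_base => [H0 i|H0 i].
    case/andP=> i0 ik; have := H0 (Ordinal ik).
    by rewrite /= i0 -ltnS prednK // ik => /eqP.
  by apply/implyP => /andP[i0 _]; rewrite H0 // i0 ltn_ord.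
rewrite addnS in dJ *; rewrite /= IH ?(ltnW dJ) //.
have HD := subsetP (trivial_upto_sub dJ) _ HJ.
have j2 : 1 < (k.-1 + d).+1 by move: k_gt2; clear; lia.
have HDj : H \in trivial_upto (k.-1 + d) by move: HD; rewrite trivial_uptoS => /andP[].
apply/setP => G; rewrite trivial_uptoS [LHS]inE.
have [GD|//] := boolP (G \in trivial_upto _).
have EG := num_cut_sets_excess j2 GD HD.
apply/forall_inP/eqP => [min|G0 K KD].
  by have := min H HDj; rewrite EG; clear; lia.
by rewrite EG G0 addn0 (num_cut_sets_excess j2 KD HD) leq_addr.
Qed.

End Classes.

Theorem theorem2p5 (k n m g : nat) (hk : 3 <= k) (hn : 2 <= n)
    (hm : 2 * m = k * n) (hg : 4 <= g) (hD : calD n m k g != set0) :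
  calA n m (g * (k - 2)) = calD n m k g.
Proof.
have le : k.-1 <= g * (k - 2) by nia.
have := @calA_trivial_upto n m k hk hn hm (g * (k - 2)) (g * (k - 2) - k.-1) hD.
by rewrite subnKC // => /(_ (leqnn _)).
Qed.
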